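(* Let $q$ be a power of a prime, $\epsilon \in \{\pm 1\}$ and $n$ a positive integer. If $\phi : \mathrm{GL}^{\epsilon}_n(q) \to \mathrm{GL}_n(\overline{\mathbb{F}_q})$ is the natural embedding and $\chi_\phi$ is the corresponding Brauer character, then $\mathbb{Q}(\chi_\phi) = \mathbb{Q}(\mathrm{GL}^{\epsilon}_n(q))$.
   Context: Notation: $\mathrm{GL}^{+1}_n(q) := \mathrm{GL}_n(q)$ and $\mathrm{GL}^{-1}_n(q) := \mathrm{GU}_n(q)$ (the general unitary group, a subgroup of $\mathrm{GL}_n(q^2)$). For a finite group $G$, $\mathbb{Q}(G) := \mathbb{Q}(\{\chi(g) : \chi \in \mathrm{Irr}(G),\ g \in G\})$, where $\mathrm{Irr}(G)$ is the set of complex irreducible characters. With $p$ the prime dividing $q$, an isomorphism from $\overline{\mathbb{F}_p}^{\times}$ to the group of roots of unity of $p'$-order in $\mathbb{C}^\times$ is fixed; the Brauer character $\chi_\phi$ sends a $p'$-element $g$ to the sum of the images under this isomorphism of the eigenvalues (with multiplicity) of $\phi(g)$, and $\mathbb{Q}(\chi_\phi)$ is the field generated over $\mathbb{Q}$ by the values of $\chi_\phi$. *)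

(* Defs.v *)
From mathcomp Require Import all_boot all_order all_algebra all_fingroup all_solvable all_field all_character.

Set Implicit Arguments.
Unset Strict Implicit.
Unset Printing Implicit Defensive.

Import Order.TTheory GroupScope GRing.Theory Num.Theory.
Local Open Scope ring_scope.

(* 'GL_n[F] consists of matrices of size n.-1.+1, which is n for n > 0. *)
Section UnitaryGroup.
Variables (F : finFieldType) (n q : nat).

(* When F has q ^ 2 elements this is the standard Hermitian form on F^n, for
   the involution x |-> x ^+ q of F. *)
Definition hermitian_form (u v : 'rV[F]_n.-1.+1) : F :=
  \sum_i u 0 i * v 0 i ^+ q.

Definition GU_set : {set {'GL_n[F]}} :=
  [set g : {'GL_n[F]} | [forall u, forall v,
     hermitian_form (u *m GLval g) (v *m GLval g) == hermitian_form u v]].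

Lemma GU_group_set : group_set GU_set.
Proof.
apply/group_setP; split=> [|g h].
  by rewrite inE; apply/'forall_forallP=> u v; rewrite GL_1E !mulmx1.
rewrite !inE => /'forall_'forall_eqP gP /'forall_'forall_eqP hP.
by apply/'forall_'forall_eqP=> u v; rewrite GL_MxE !mulmxA hP gP.
Qed.

Canonical GU : {group {'GL_n[F]}} := Group GU_group_set.

End UnitaryGroup.

Arguments GU F n q : clear implicits.

(* The field of definition of GL^eps_n(q) has q elements if eps = 1 and q ^ 2
   elements if eps = -1. *)
Definition GLeps_field_order (eps : int) (q : nat) : nat :=
  if eps == 1 then q else (q ^ 2)%N.

Definition GLeps (F : finFieldType) (n : nat) (eps : int) (q : nat) :
    {group {'GL_n[F]}} :=
  if eps == 1 then [set: {'GL_n[F]}]%G else GU F n q.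

Section NaturalRepresentation.
Variables (F : finFieldType) (K : fieldType) (iota : {rmorphism F -> K}).
Variables (n : nat) (G : {group {'GL_n[F]}}).

Definition natural_mx (g : {'GL_n[F]}) : 'M[K]_n.-1.+1 :=
  map_mx iota (GLval g).

Lemma natural_mx_repr : mx_repr G natural_mx.
Proof.
split=> [|g h _ _]; first by rewrite /natural_mx GL_1E map_mx1.
by rewrite /natural_mx GL_MxE map_mxM.
Qed.

Canonical natural_repr : mx_representation K G n.-1.+1 :=
  MxRepresentation natural_mx_repr.

End NaturalRepresentation.

Definition is_algebraic_closure (F : fieldType) (K : closedFieldType)
    (iota : {rmorphism F -> K}) : Prop :=
  forall x : K, algebraicOver iota x.

(* theta restricts to a group isomorphism from K^* onto the roots of unity of
   order prime to p; its value at 0 is irrelevant. *)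
Definition is_root_lift (p : nat) (K : fieldType) (theta : K -> algC) : Prop :=
  [/\ {in predC1 0 &, {morph theta : x y / x * y}},
      {in predC1 0 &, injective theta},
      {in predC1 0, forall x,
         exists2 m, p^'.-nat m & m.-primitive_root (theta x)}
    & forall m z, p^'.-nat m -> m.-primitive_root z ->
        exists2 x, x != 0 & theta x = z].

(* With multiplicities, and sorted arbitrarily. *)
Definition eigenvalues (K : closedFieldType) (m : nat) (A : 'M[K]_m) : seq K :=
  sval (closed_field_poly_normal (char_poly A)).

Definition Brauer_char (gT : finGroupType) (G : {group gT})
    (K : closedFieldType) (m : nat) (theta : K -> algC)
    (phi : mx_representation K G m) (g : gT) : algC :=
  \sum_(z <- eigenvalues (phi g)) theta z.

(* The subfield Q(S) of algC generated by S. *)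
Inductive Qgen (S : algC -> Prop) : algC -> Prop :=
| Qgen_mem x of S x : Qgen S x
| Qgen_one : Qgen S 1
| Qgen_sub x y of Qgen S x & Qgen S y : Qgen S (x - y)
| Qgen_div x y of Qgen S x & Qgen S y : Qgen S (x / y).

Definition Q_Brauer (p : nat) (gT : finGroupType) (G : {group gT})
    (K : closedFieldType) (m : nat) (theta : K -> algC)
    (phi : mx_representation K G m) : algC -> Prop :=
  Qgen (fun z => exists g, [/\ g \in G, p^'.-elt g & z = Brauer_char theta phi g]).

(* Complex characters are algC-valued, so nothing is lost by working in algC. *)
Definition Q_group (gT : finGroupType) (G : {group gT}) : algC -> Prop :=
  Qgen (fun z => exists (i : Iirr G) (g : gT), g \in G /\ z = 'chi_i g).

(* Main.v *)
Require Import Defs.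
From HB Require Import structures.
From mathcomp Require Import all_boot all_order all_algebra all_fingroup all_solvable all_field all_character.
From mathcomp Require Import zify ring.

Set Implicit Arguments.
Unset Strict Implicit.
Unset Printing Implicit Defensive.

Import Order.TTheory GroupScope GRing.Theory Num.Theory.
Local Open Scope ring_scope.

(** Write G for GL^eps_n(q) and N for its order. The values of the ordinary
characters of G and those of chi_phi are sums of N-th roots of unity, so both
fields lie in Q(zeta_N) and, by the Galois correspondence [Qgen_galois], they
coincide as soon as an automorphism nu of the complex numbers fixes all ordinary
characters exactly when it fixes chi_phi. If nu raises N-th roots of unity to
the power m, it moves the value of either kind of character at g to its value at
g ^ m [unity_power_sum_aut].

If nu fixes all chi in Irr(G), then g ^ m is conjugate to g by column
orthogonality, hence chi_phi takes the same value at both.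

The converse is [power_conj]: if chi_phi(t ^ m) = chi_phi(t) for all p'-elements
t of G, then g ^ m is conjugate to g for all g in G, including those of order
divisible by p. View G as the fixed points of a Steinberg endomorphism of
GL_n(K), which acts on eigenvalues by sigma(x) = x ^ q, or by sigma(x) = x ^ (-q)
in the unitary case.
- Let b be an eigenvalue of a p'-element s of G, and let O be its sigma-orbit.
  The matrix t which acts as s on the eigenspaces of s for O, and trivially on the
  others, is a polynomial in s and belongs to G because O is
  sigma-stable [steinberg_spectral]. Its eigenvalues are those in O and possibly 1. By Fourier
  inversion on <[t]>, chi_phi determines the eigenvalues of t with their
  multiplicities, so that they are permuted by x |-> x ^ m and b ^ m lies in O
  [semisimple_eigenvalue_power]. Applied to a power s = g ^ (p ^ e) this shows
  that a ^ m is in the sigma-orbit of a for each eigenvalue a of any g in G.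
- The ranks of the powers of g - a only depend on the sigma-orbit of a, since g is
  fixed by the Steinberg endomorphism [steinberg_jordan]. So they are the same
  for a and a ^ m, and f(g) and f(g ^ m) have the same rank for every polynomial
  f. Over a finite field this makes g and g ^ m similar [similar_rank], by the
  decomposition of a finite-dimensional module into cyclic ones.
- In the unitary case let x conjugate g to g ^ m in GL_n(q ^ 2). The hermitian
  matrix x x^* commutes with g. It is of the form c c^* where c commutes with
  everything that commutes with x x^* [hermitian_norm], and therefore with g.
  Then c^-1 x is a unitary matrix which conjugates g to g ^ m [unitary_conj]. *)

(** * Cyclic submodules and their complements *)
Section Krylov.
Variables (F : fieldType) (n' : nat).
Local Notation n := n'.+1.
Implicit Types (A B U W : 'M[F]_n) (v w z : 'rV[F]_n) (f mu rho : {poly F}).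

Definition krylov A v d : 'M_(d, n) := \matrix_(i < d) (v *m A ^+ i).

(** The monic generator of the annihilator of v is mu up to a scalar: in terms of
the F['X]-module structure given by A, the submodule spanned by v is F['X]/mu. *)
Definition has_order A v mu :=
  forall f, (v *m horner_mx A f == 0) = (mu %| f).

Lemma mul_krylov A v d (u : 'rV_d) :
  u *m krylov A v d = v *m horner_mx A (rVpoly u).
Proof.
rewrite mulmx_sum_row [rVpoly u]poly_def rmorph_sum mulmx_sumr.
apply: eq_bigr => i _; rewrite valK /= linearZ rmorphXn /= horner_mx_X rowK.
by rewrite -scalemxAr.
Qed.

Lemma horner_order_mod A v mu f : has_order A v mu ->
  v *m horner_mx A (f %% mu) = v *m horner_mx A f.
Proof.
move=> ord_v; rewrite [in RHS](divp_eq f mu) rmorphD rmorphM mulmxDr /=.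
have /eqP v_mu : v *m horner_mx A mu == 0 by rewrite ord_v.
by rewrite comm_horner_mx2 mulmxA v_mu mul0mx add0r.
Qed.

Lemma krylov_free A v mu : mu != 0 -> has_order A v mu ->
  row_free (krylov A v (size mu).-1).
Proof.
move=> mu0 ord_v.
rewrite -kermx_eq0; apply/rowV0P => u /sub_kermxP.
rewrite mul_krylov => /eqP; rewrite ord_v => mu_u.
apply: (can_inj rVpolyK); rewrite linear0.
apply: contraTeq mu_u => u0; apply: contraTN isT => /(dvdp_leq u0).
by rewrite leqNgt (leq_ltn_trans (size_poly _ _)) // prednK ?size_poly_gt0.
Qed.

Lemma krylov_sub A v mu f : mu != 0 -> has_order A v mu ->
  (v *m horner_mx A f <= krylov A v (size mu).-1)%MS.
Proof.
move=> mu0 ord_v; rewrite -(horner_order_mod f ord_v).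
rewrite -(@poly_rV_K _ (size mu).-1 (f %% mu)) -?mul_krylov ?submxMl //.
by rewrite -ltnS prednK ?size_poly_gt0 // ltn_modp.
Qed.

Lemma krylov_horner A v d (u : 'rV_n) : (u <= krylov A v d)%MS ->
  exists2 f : {poly F}, (size f <= d)%N & u = v *m horner_mx A f.
Proof.
case/submxP=> c ->; exists (rVpoly c); first exact: size_poly.
exact: mul_krylov.
Qed.

(** Pick a linear form phi which reads off the coefficient of degree d - 1 on the
cyclic module spanned by z = v rho(A), where d is the degree of mu. The
complement is the set of w in U such that phi vanishes on the whole module
spanned by w rho(A). As rho(A) maps U into the kernel of mu(A), this is imposed
by d linear equations only, whence the dimension; and a nonzero f(A), with f of
degree less than d, is moved into degree d - 1 by some power of A. *)
Lemma cyclic_complement A U v mu rho :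
    stablemx U A -> (v <= U)%MS -> has_order A v mu -> (1 < size mu)%N ->
    coprimep mu rho -> U *m horner_mx A (mu * rho) = 0 ->
  exists W : 'M_n, [/\ stablemx W A, (<<krylov A v (size mu).-1>> :&: W = 0)%MS
    & (<<krylov A v (size mu).-1>> + W :=: U)%MS].
Proof.
move=> stU Uv ord_v mu_gt1 co_mu U0.
have mu0 : mu != 0 by rewrite -size_poly_gt0 ltnW.
set d := (size mu).-1; have d_gt0 : (0 < d)%N by rewrite -ltnS prednK // ltnW.
have Dd : d.-1.+1 = d by rewrite prednK.
pose z := v *m horner_mx A rho.
have ord_z : has_order A z mu.
  by move=> f; rewrite -mulmxA mulmxE -rmorphM ord_v Gauss_dvdpr.
have free_z := krylov_free mu0 ord_z; rewrite -/d in free_z.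
have d1 : (d.-1 < d)%N by rewrite Dd.
pose top := Ordinal d1.
have [phi phiE] : exists phi : 'cV_n, forall f, (size f <= d)%N ->
    z *m horner_mx A f *m phi = (f`_d.-1)%:M.
  exists (pinvmx (krylov A z d) *m delta_mx top 0) => f szf.
  rewrite -(poly_rV_K szf) -mul_krylov poly_rV_K // mulmxA mulmxKp //.
  by rewrite -colE; apply/matrixP=> i j; rewrite !ord1 !mxE eqxx.
(* The columns of Phi are the d equations of W inside U. *)
pose Phi := \matrix_(i < n, j < d) (horner_mx A (rho * 'X^j) *m phi) i 0.
have PhiE (w : 'rV_n) j : (w *m Phi) 0 j = (w *m horner_mx A (rho * 'X^j) *m phi) 0 0.
  by rewrite -mulmxA !mxE; apply: eq_bigr => i _; rewrite mxE.
pose W := (U :&: kermx Phi)%MS.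
have inW (w : 'rV_n) : (w <= U)%MS ->
   (forall f, w *m horner_mx A (rho * f) *m phi = 0) <-> (w <= W)%MS.
  move=> Uw; rewrite sub_capmx Uw; split=> [w0 | /sub_kermxP w0 f].
    apply/sub_kermxP/matrixP=> i j.
    by rewrite ord1 PhiE w0 !mxE.
  have wmu : w *m horner_mx A rho *m horner_mx A mu = 0.
    rewrite -mulmxA mulmxE -rmorphM mulrC; case/submxP: Uw => c ->.
    by rewrite -mulmxA U0 mulmx0.
  rewrite (divp_eq f mu) mulrDr rmorphD mulmxDr mulmxDl /=.
  rewrite [X in rho * X]mulrC mulrA !rmorphM /= -!mulmxE !mulmxA wmu !mul0mx add0r.
  have: (size (f %% mu)%R <= d)%N by rewrite -ltnS prednK ?ltn_modp ?size_poly_gt0.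
  move: (f %% mu) => h szh; rewrite -(poly_rV_K szh).
  rewrite [rVpoly _]poly_def linear_sum mulmx_sumr mulmx_suml big1 // => i _ /=.
  rewrite valK /= linearZ -scalemxAr -scalemxAl /=.
  rewrite -(mulmxA w) mulmxE -rmorphM.
  set x := _ *m phi; suff -> : x = 0 by rewrite scaler0.
  by apply/matrixP=> a b; rewrite !ord1 [RHS]mxE -PhiE w0 mxE.
exists W; set C := <<_>>%MS.
have CW0 : (C :&: W = 0)%MS.
  apply/eqP/rowV0P => u; rewrite sub_capmx genmxE => /andP[/krylov_horner[f szf ->]] Wu.
  have [-> | f0] := eqVneq f 0; first by rewrite rmorph0 mulmx0.
  have /inW: (v *m horner_mx A f <= U)%MS.
    by rewrite (submx_trans _ (horner_mx_stable f stU)) // submxMr.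
  case=> _ /(_ Wu 'X^(d - size f))/matrixP/(_ 0 0).
  rewrite -(mulmxA v) mulmxE -rmorphM mulrCA rmorphM -mulmxE (mulmxA v) phiE; last first.
    by rewrite size_Mmonic ?monicXn // size_polyXn addnS /= addnC subnK.
  have sf0 : (0 < size f)%N by rewrite size_poly_gt0.
  have -> : (f * 'X^(d - size f))`_d.-1 = lead_coef f.
    rewrite coefMXn lead_coefE; case: ltnP => [|_]; first by lia.
    by congr (_`_ _); lia.
  by rewrite !mxE mulr1n => /eqP; rewrite lead_coef_eq0 (negPf f0).
have CU : (C <= U)%MS.
  rewrite genmxE; apply/row_subP=> i; rewrite rowK.
  rewrite -(horner_mx_X A) -rmorphXn (submx_trans _ (horner_mx_stable 'X^i stU)) //.
  by rewrite submxMr.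
split=> //.
  apply/row_subP=> i; rewrite row_mul.
  have := row_sub i W; move: (row i W) => w Ww.
  have Uw : (w <= U)%MS by apply: submx_trans Ww (capmxSl _ _).
  apply/inW; first by rewrite (submx_trans _ stU) // submxMr.
  move=> f; rewrite -{1}(horner_mx_X A) -(mulmxA w) mulmxE -rmorphM mulrCA.
  by move/inW: Ww; apply.
apply/eqmxP; rewrite -(geq_leqif (mxrank_leqif_eq _)); last first.
  by rewrite addsmx_sub CU capmxSl.
rewrite mxrank_disjoint_sum // mxrank_gen.
rewrite (eqP (krylov_free mu0 ord_v)) -(mxrank_mul_ker U Phi) leq_add2r.
exact: rank_leq_col.
Qed.

End Krylov.

(** * Similarity of matrices with equal ranks *)
Section Irr.
Variable F : finFieldType.
Implicit Types p q g : {poly F}.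

Lemma ltn_size_factor a b k : (1 < a -> (b + a).-1 < k.+1 -> b < k)%N.
Proof. lia. Qed.

Lemma irreducible_divisor p : (1 < size p)%N ->
  exists2 q, irreducible_poly q & q %| p.
Proof.
have [k] := ubnP (size p); elim: k p => // k IHk p sz_p p_gt1.
have [|/negP] := boolP (irreducibleb p).
  by move/irreducibleP=> irr_p; exists p.
rewrite /irreducibleb p_gt1 /= => /negP; rewrite negb_forall => /existsP[q].
rewrite negb_imply -ltnNge => /andP[]; rewrite -Pdiv.Idomain.dvdpE => q_p q_gt1.
have sz_q : (size (q : {poly F}) < k)%N.
  by apply: leq_ltn_trans (size_npoly q) _; rewrite prednK ?(ltnW p_gt1).
by have [r irr_r r_q] := IHk _ sz_q q_gt1; exists r => //; apply: dvdp_trans q_p.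
Qed.

Lemma irreducible_factor p g : irreducible_poly p -> g != 0 ->
  exists j r, g = p ^+ j * r /\ coprimep p r.
Proof.
move=> irr_p; have [k] := ubnP (size g); elim: k g => // k IHk g sz_g g0.
have [/dvdpP[r Dg]|] := boolP (p %| g); last first.
  by rewrite -irreducible_poly_coprime // => co_pg; exists 0%N, g; rewrite mul1r.
have [r0 p0] : r != 0 /\ p != 0.
  by apply/andP; rewrite -negb_or -mulf_eq0 -Dg.
have sz_r : (size r < k)%N.
  by rewrite Dg size_mul // in sz_g; apply: ltn_size_factor sz_g; apply: irr_p.1.
have [j [s [Dr co_ps]]] := IHk _ sz_r r0.
by exists j.+1, s; split; rewrite // Dg Dr exprSr mulrAC.
Qed.

End Irr.

Section Sim.
Variables (F : finFieldType) (n' : nat).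
Local Notation n := n'.+1.
Implicit Types (A B U W T : 'M[F]_n) (v w z : 'rV[F]_n) (f mu rho : {poly F}).

(** Remove irreducible factors from the characteristic polynomial as long as the
result still annihilates U: when a factor p can not be removed, the power of p
that is left is the p-primary part of the minimal polynomial of A on U. *)
Lemma primary_annihilator A U : U != 0 ->
  exists p j rho, [/\ irreducible_poly p, coprimep p rho,
    U *m horner_mx A (p ^+ j.+1 * rho) = 0 & U *m horner_mx A (p ^+ j * rho) != 0].
Proof.
move=> U0; have: U *m horner_mx A (char_poly A) = 0.
  by rewrite Cayley_Hamilton mulmx0.
have: char_poly A != 0 by rewrite monic_neq0 ?char_poly_monic.
move: (char_poly A) => f; have [k] := ubnP (size f).
elim: k f => // k IHk f sz_f f0 Uf.
have f_gt1 : (1 < size f)%N.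
  rewrite ltnNge; apply: contra U0 => f_le1; move: Uf f0.
  rewrite (size1_polyC f_le1) horner_mx_C mul_mx_scalar polyC_eq0 => /eqP.
  by rewrite scaler_eq0 => /orP[/eqP-> | //]; rewrite eqxx.
have [p irr_p /dvdpP[g Df]] := irreducible_divisor f_gt1.
have [g0 p0] : g != 0 /\ p != 0.
  by apply/andP; rewrite -negb_or -mulf_eq0 -Df.
have [Ug | Ug] := eqVneq (U *m horner_mx A g) 0.
  apply: (IHk g) => //; rewrite Df size_mul // in sz_f.
  by apply: ltn_size_factor sz_f; apply: irr_p.1.
have [j [r [Dg co_pr]]] := irreducible_factor irr_p g0.
by exists p, j, r; split; rewrite // -?Dg // exprSr mulrAC -Dg -Df.
Qed.

(** A vector killed by p ^ (j + 1) but not by p ^ j has order p ^ (j + 1): if f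
kills it and the exponent i of p in f is at most j, then by Bezout so does p ^ i. *)
Lemma primary_vector A U p j rho :
    irreducible_poly p -> U *m horner_mx A (p ^+ j.+1 * rho) = 0 ->
    U *m horner_mx A (p ^+ j * rho) != 0 ->
  exists2 v, (v <= U *m horner_mx A rho)%MS & has_order A v (p ^+ j.+1).
Proof.
move=> irr_p Uf0 /rowV0Pn[w0 /submxP[c ->]] cU0.
exists (c *m U *m horner_mx A rho); first by rewrite -mulmxA submxMl.
have v_mu f : c *m U *m horner_mx A rho *m horner_mx A (p ^+ j.+1 * f) = 0.
  rewrite -!mulmxA mulmxE -!rmorphM mulrCA mulrA rmorphM /= -mulmxE (mulmxA U).
  by rewrite Uf0 mul0mx mulmx0.
move=> f; apply/eqP/idP => [vf0 | /dvdpP[g ->]]; last by rewrite mulrC v_mu.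
have [-> | f0] := eqVneq f 0; first exact: dvdp0.
have [i [r [Df co_pr]]] := irreducible_factor irr_p f0.
have [lt_ij | le_ij] := leqP j.+1 i; first by rewrite Df dvdp_mulr ?dvdp_exp2l.
have /Bezout_eq1_coprimepP[[a b] /= ab1] : coprimep r (p ^+ j.+1).
  by rewrite coprimep_sym coprimep_expl.
case/eqP: cU0; rewrite mulmxA mulrC rmorphM -mulmxE (mulmxA (c *m U)) /=.
have -> : p ^+ j = f * (a * p ^+ (j - i)) + p ^+ j.+1 * (p ^+ j * b).
  rewrite -[LHS]mulr1 -ab1 Df mulrDr -{1}(subnKC (n := j) (m := i)) // exprD.
  by rewrite mulrC [in RHS]mulrC; congr (_ + _); [ring | ring].
rewrite rmorphD mulmxDr v_mu rmorphM -mulmxE (mulmxA _ (horner_mx A f)).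
by rewrite vf0 mul0mx addr0.
Qed.

Lemma cyclic_iso A B v v' mu : mu != 0 -> has_order A v mu -> has_order B v' mu ->
  exists T : 'M[F]_n, forall f, v *m horner_mx A f *m T = v' *m horner_mx B f.
Proof.
move=> mu0 ord_v ord_v'; set d := (size mu).-1.
exists (pinvmx (krylov A v d) *m krylov B v' d) => f.
rewrite -(horner_order_mod f ord_v) -(horner_order_mod f ord_v').
have szf : (size (f %% mu)%R <= d)%N by rewrite -ltnS prednK ?ltn_modp ?size_poly_gt0.
by rewrite -(poly_rV_K szf) -!mul_krylov mulmxA mulmxKp ?krylov_free.
Qed.

Lemma horner_intertwine A B U T f : stablemx U A -> U *m A *m T = U *m T *m B ->
  U *m horner_mx A f *m T = U *m T *m horner_mx B f.
Proof.
move=> stU UT; elim/poly_ind: f => [|f c IHf].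
  by rewrite !rmorph0 !(mulmx0, mul0mx).
rewrite !rmorphD !rmorphM /= !horner_mx_X !horner_mx_C !mulmxDr !mulmxDl.
rewrite -!mulmxE !mulmxA -IHf; congr (_ + _).
  have /submxP[D ->] : (U *m horner_mx A f <= U)%MS by apply: horner_mx_stable.
  by rewrite -!(mulmxA D) UT.
by rewrite !mul_mx_scalar -scalemxAl.
Qed.

Lemma cyclic_module_iso A B v v' mu (d := (size mu).-1)
    (C := <<krylov A v d>>%MS) (C' := <<krylov B v' d>>%MS) :
    mu != 0 -> has_order A v mu -> has_order B v' mu ->
  exists2 T : 'M[F]_n, (C *m T :=: C')%MS & C *m A *m T = C *m T *m B.
Proof.
move=> mu0 ord_v ord_v'; have [T vT] := cyclic_iso mu0 ord_v ord_v'; exists T.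
  apply: eqmx_trans (eqmxMr _ (genmxE _)) _.
  suff -> : krylov A v d *m T = krylov B v' d by apply/eqmx_sym/genmxE.
  apply/row_matrixP=> i; rewrite row_mul !rowK.
  by rewrite -(horner_mx_X A) -rmorphXn /= vT rmorphXn /= horner_mx_X.
apply/row_matrixP=> i; rewrite !row_mul.
have : (row i C <= krylov A v d)%MS by rewrite (submx_trans (row_sub _ _)) ?genmxE.
case/krylov_horner=> f _ ->; rewrite vT.
rewrite -{2}(horner_mx_X A) -(mulmxA v) mulmxE -rmorphM vT.
by rewrite rmorphM /= -mulmxE mulmxA horner_mx_X.
Qed.

Lemma cyclic_stable A v mu : mu != 0 -> has_order A v mu ->
  stablemx <<krylov A v (size mu).-1>>%MS A.
Proof.
move=> mu0 ord_v; rewrite (eqmxMr _ (genmxE _)) genmxE; apply/row_subP=> i.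
rewrite row_mul rowK -mulmxA mulmxE -exprSr -[A in A ^+ _]horner_mx_X -rmorphXn.
exact: krylov_sub.
Qed.

(** Induction on the dimension. The hypothesis forces A on U and B on U' to have the
same annihilator, so U and U' both contain a cyclic module with the same primary
annihilator p ^ (j + 1), split off by [cyclic_complement]. These cyclic modules
are isomorphic, so their contributions to the ranks cancel and the induction
hypothesis applies to the complements. *)
Lemma stable_iso A B U U' : stablemx U A -> stablemx U' B ->
    (forall f, \rank (U *m horner_mx A f) = \rank (U' *m horner_mx B f)) ->
  exists2 T : 'M[F]_n, (U *m T :=: U')%MS & U *m A *m T = U *m T *m B.
Proof.
have [k] := ubnP (\rank U); elim: k U U' => // k IHk U U' rkU stU stU' eq_rk.
have eq0 f : (U *m horner_mx A f == 0) = (U' *m horner_mx B f == 0).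
  by rewrite -!mxrank_eq0 eq_rk.
have [U0 | nzU] := eqVneq U 0.
  have:= eq0 1; rewrite !rmorph1 !mulmx1 U0 eqxx => /esym/eqP->.
  by exists 0; rewrite ?mul0mx.
have [p [j [rho [irr_p co_pr Umu Umu']]]] := primary_annihilator A nzU.
have [U'mu U'mu'] : U' *m horner_mx B (p ^+ j.+1 * rho) = 0
                  /\ U' *m horner_mx B (p ^+ j * rho) != 0.
  by split; [apply/eqP; rewrite -eq0 Umu | rewrite -eq0].
have [v Uv ord_v] := primary_vector irr_p Umu Umu'.
have [v' Uv' ord_v'] := primary_vector irr_p U'mu U'mu'.
have mu_gt1 : (1 < size (p ^+ j.+1))%N.
  have := size_exp p j.+1; have := irr_p.1.
  by case: (size p) => [|[|s]] // _; case: (size _) => [|[|//]] /=; rewrite ?mulSn.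
have co_mu : coprimep (p ^+ j.+1) rho by rewrite coprimep_expl.
have mu0 : p ^+ j.+1 != 0 by rewrite -size_poly_gt0 ltnW.
have Uv1 := submx_trans Uv (horner_mx_stable rho stU).
have Uv1' := submx_trans Uv' (horner_mx_stable rho stU').
have stC := cyclic_stable mu0 ord_v; have stC' := cyclic_stable mu0 ord_v'.
have [W [stW]] := cyclic_complement stU Uv1 ord_v mu_gt1 co_mu Umu.
have [W' [stW']] := cyclic_complement stU' Uv1' ord_v' mu_gt1 co_mu U'mu.
have [T1 CT1 CT1A] := cyclic_module_iso mu0 ord_v ord_v'.
have [T1' CT1' CT1A'] := cyclic_module_iso mu0 ord_v' ord_v.
have := krylov_free mu0 ord_v.
move: CT1 CT1A CT1' CT1A' stC stC'.
rewrite /row_free -mxrank_gen.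
move: <<krylov A v _>>%MS <<krylov B v' _>>%MS => C C'.
move=> CT1 CT1A CT1' CT1A' stC stC' /eqP rkC CW' defU' CW defU.
have rk_sum (A0 C0 W0 U0 : 'M[F]_n) f : stablemx C0 A0 -> stablemx W0 A0 ->
    (C0 :&: W0 = 0)%MS -> (C0 + W0 :=: U0)%MS ->
    \rank (U0 *m horner_mx A0 f) =
      (\rank (C0 *m horner_mx A0 f) + \rank (W0 *m horner_mx A0 f))%N.
  move=> stC0 stW0 CW0 defU0; rewrite -(eqmxMr _ defU0) addsmxMr mxrank_disjoint_sum //.
  by apply/eqP; rewrite -submx0 -CW0 capmxS ?horner_mx_stable.
have rk_le (A0 B0 C0 C0' T0 : 'M[F]_n) f : stablemx C0 A0 ->
    (C0 *m T0 :=: C0')%MS -> C0 *m A0 *m T0 = C0 *m T0 *m B0 ->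
    (\rank (C0' *m horner_mx B0 f) <= \rank (C0 *m horner_mx A0 f))%N.
  move=> stC0 CT0 CT0A; rewrite -(eqmxMr _ CT0) -(horner_intertwine f stC0 CT0A).
  exact: mxrankM_maxl.
have rk_C f : \rank (C *m horner_mx A f) = \rank (C' *m horner_mx B f).
  by apply/eqP; rewrite eqn_leq (rk_le _ _ _ _ T1') ?(rk_le _ _ _ _ T1).
have rk_W f : \rank (W *m horner_mx A f) = \rank (W' *m horner_mx B f).
  have := eq_rk f; rewrite (rk_sum A C W U f) // (rk_sum B C' W' U' f) //.
  by rewrite rk_C => /addnI.
have [|T2 WT2 WT2A] := IHk W W' _ stW stW' rk_W.
  apply: leq_trans (rkU : (\rank U <= k)%N); rewrite -defU mxrank_disjoint_sum // rkC.
  by rewrite -add1n leq_add2r -ltnS prednK // ltnW.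
pose T := proj_mx C W *m T1 + proj_mx W C *m T2.
have WC : (W :&: C = 0)%MS by rewrite capmxC.
have CT m (D : 'M_(m, n)) : (D <= C)%MS -> D *m T = D *m T1.
  move=> sDC; rewrite mulmxDr (mulmxA D (proj_mx C W)) (mulmxA D (proj_mx W C)).
  by rewrite proj_mx_id // (proj_mx_0 WC) // mul0mx addr0.
have WT m (D : 'M_(m, n)) : (D <= W)%MS -> D *m T = D *m T2.
  move=> sDW; rewrite mulmxDr (mulmxA D (proj_mx C W)) (mulmxA D (proj_mx W C)).
  by rewrite [D *m proj_mx W C]proj_mx_id // (proj_mx_0 CW) // mul0mx add0r.
exists T.
  apply: eqmx_trans (eqmxMr _ (eqmx_sym defU)) _; apply: eqmx_trans (addsmxMr _ _ _) _.
  by rewrite CT // WT //; apply: eqmx_trans (adds_eqmx CT1 WT2) defU'.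
have /submxP[D ->] : (U <= col_mx C W)%MS by rewrite -defU addsmxE.
rewrite -!mulmxA; congr (_ *m _); rewrite !mulmxA !mul_col_mx.
by rewrite !(CT _ C) ?(CT _ (C *m A)) ?(WT _ W) ?(WT _ (W *m A)) // CT1A WT2A.
Qed.

(** The ranks of all f(A) determine the F['X]-module defined by A. The interest of
this form of the classification is that a rank does not change under a field
extension, which reduces similarity over a finite field to eigenvalue ranks over
its algebraic closure. *)
Theorem similar_rank A B :
    (forall f, \rank (horner_mx A f) = \rank (horner_mx B f)) ->
  exists2 T : 'M[F]_n, T \in unitmx & A *m T = T *m B.
Proof.
move=> eq_rk; have [||f|T] := @stable_iso A B 1%:M 1%:M; rewrite ?mul1mx ?submx1 //.
move=> /eqmxP/andP[_ T1] eqT; exists T => //.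
by rewrite -row_full_unit -sub1mx.
Qed.

End Sim.

(** * A matrix and its powers *)
Lemma expr1_neq0 (R : nzRingType) (x : R) N : (0 < N)%N -> x ^+ N = 1 -> x != 0.
Proof.
move=> N0; apply: contra_eq_neq => ->.
by rewrite expr0n eqn0Ngt N0 eq_sym oner_eq0.
Qed.

Section EigenRank.
Variables (K : fieldType) (n' : nat).
Local Notation n := n'.+1.
Implicit Types (A B : 'M[K]_n) (a b : K) (f g : {poly K}).

(** The ranks of the powers of A - a encode the sizes of the Jordan blocks of A for
the eigenvalue a. *)
Definition same_jordan A a b :=
  forall j, \rank ((A - a%:M) ^+ j) = \rank ((A - b%:M) ^+ j).

Lemma horner_mx_XsubC_exp A a j :
  horner_mx A (('X - a%:P) ^+ j) = (A - a%:M) ^+ j.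
Proof. by rewrite rmorphXn rmorphB /= horner_mx_X horner_mx_C. Qed.

Lemma mxrank_horner_dvdp A f g : f %| g ->
  (\rank (horner_mx A g) <= \rank (horner_mx A f))%N.
Proof. by case/dvdpP=> h ->; rewrite rmorphM -mulmxE mxrankM_maxr. Qed.

Lemma eigenvalueNunit A a : ~~ eigenvalue A a = (A - a%:M \in unitmx).
Proof. by rewrite negbK kermx_eq0 row_free_unit. Qed.

Lemma mxrank_exp_noneigen A a j :
  ~~ eigenvalue A a -> \rank ((A - a%:M) ^+ j) = n.
Proof. by rewrite eigenvalueNunit => Aa; rewrite mxrank_unit // unitrX. Qed.

Lemma same_jordan_eigenvalue A a b :
  same_jordan A a b -> eigenvalue A a -> eigenvalue A b.
Proof.
move=> /(_ 1%N); rewrite !expr1 => sj; apply: contraLR.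
by rewrite !eigenvalueNunit -!row_free_unit /row_free sj.
Qed.

Lemma mulmx_eigen_expr m (D : 'M_(m, n)) A a j :
  D *m A = a *: D -> D *m A ^+ j = a ^+ j *: D.
Proof.
move=> DA; elim: j => [|j IHj]; first by rewrite mulmx1 scale1r.
by rewrite exprSr mulmxA IHj -scalemxAl DA scalerA -exprSr.
Qed.

Lemma eigenvalue_expr A a N : A ^+ N = 1 -> eigenvalue A a -> a ^+ N = 1.
Proof.
move=> AN /eigenvalueP[v /(mulmx_eigen_expr N) + v0].
rewrite AN mulmx1 => /eqP; rewrite -subr_eq0 -[X in X - _]scale1r -scalerBl.
by rewrite scaler_eq0 (negPf v0) orbF subr_eq0 => /eqP.
Qed.

(** A - a divides A ^ k - a ^ k, which itself divides A ^ (k l) - a ^ (k l) = A - a. *)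
Lemma mxrank_exp_power A a N k l j :
    A ^+ N = 1 -> a ^+ N = 1 -> (k * l = 1 %[mod N])%N ->
  \rank ((A ^+ k - (a ^+ k)%:M) ^+ j) = \rank ((A - a%:M) ^+ j).
Proof.
move=> AN aN kl1.
have rk_le B b i : (\rank ((B ^+ i - (b ^+ i)%:M) ^+ j) <= \rank ((B - b%:M) ^+ j))%N.
  have -> : (B ^+ i - (b ^+ i)%:M) ^+ j = horner_mx B (('X^i - (b ^+ i)%:P) ^+ j).
    by rewrite [RHS]rmorphXn rmorphB /= horner_mx_C [horner_mx B _]rmorphXn /= horner_mx_X.
  rewrite -horner_mx_XsubC_exp mxrank_horner_dvdp // dvdp_exp2r //.
  by rewrite dvdp_XsubCl /root !hornerE subrr.
have modN (R : nzRingType) (x : R) : x ^+ N = 1 -> x ^+ k ^+ l = x.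
  by move=> xN; rewrite -exprM -(expr_mod _ xN) kl1 expr_mod.
apply/eqP; rewrite eqn_leq rk_le /=.
by have := rk_le (A ^+ k) (a ^+ k) l; rewrite !modN.
Qed.

(** The rank of A ^ k - a is that of A - b where b ^ k = a. As b is an iterated k-th
power of a, the Jordan blocks for a and b are the same. *)
Lemma same_jordan_power A N k : (0 < N)%N -> A ^+ N = 1 -> coprime k N ->
    (forall a, eigenvalue A a -> same_jordan A a (a ^+ k)) ->
  forall a j, \rank ((A ^+ k - a%:M) ^+ j) = \rank ((A - a%:M) ^+ j).
Proof.
move=> N0 AN co_kN sjA a j.
have AkN : (A ^+ k) ^+ N = 1 by rewrite exprAC AN expr1n.
have [aN | aN'] := eqVneq (a ^+ N) 1; last first.
  by rewrite !mxrank_exp_noneigen //; apply: contraNN aN' => /eigenvalue_expr->.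
pose l := (k ^ (totient N).-1)%N; pose b := a ^+ l.
have kl1 : (k * l = 1 %[mod N])%N.
  by rewrite -expnS prednK ?totient_gt0 // Euler_exp_totient.
have bN : b ^+ N = 1 by rewrite exprAC aN expr1n.
have Da : a = b ^+ k.
  by rewrite -exprM mulnC -(expr_mod _ aN) kl1 expr_mod.
rewrite {1}Da (mxrank_exp_power _ AN bN kl1).
have [eig_a | eig'a] := boolP (eigenvalue A a).
  rewrite /b /l; elim: (totient N).-1 j => [|i IHi] j; first by rewrite expr1.
  have eig_ai : eigenvalue A (a ^+ (k ^ i)).
    by apply: same_jordan_eigenvalue eig_a => m; rewrite IHi.
  by rewrite expnSr exprM -(sjA _ eig_ai) IHi.
rewrite !mxrank_exp_noneigen //; apply: contraNN eig'a => eig_b.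
by rewrite Da; apply: same_jordan_eigenvalue (eig_b); apply: sjA.
Qed.

End EigenRank.

(** By the kernel decomposition, the kernel of f(A) is the direct sum of the kernels
for the primary factors of f, which are powers of linear polynomials. *)
Lemma mxrank_horner_closed (K : closedFieldType) n' (A B : 'M[K]_n'.+1) :
    (forall a j, \rank ((A - a%:M) ^+ j) = \rank ((B - a%:M) ^+ j)) ->
  forall f, \rank (horner_mx A f) = \rank (horner_mx B f).
Proof.
move=> eq_rk f; have [-> | f0] := eqVneq f 0; first by rewrite !rmorph0 !mxrank0.
have [rs ->] := closed_field_poly_normal f.
rewrite !linearZ !mxrank_scale_nz ?lead_coef_eq0 //.
rewrite -big_undup_iterop_count /=; set s := undup rs.
pose p (i : 'I_(size s)) := ('X - (s`_i)%:P) ^+ count_mem s`_i rs.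
have -> : \prod_(i <- s) iterop (count_mem i rs) *%R ('X - i%:P) 1 = \prod_i p i.
  by rewrite (big_nth 0) big_mkord.
have co_p : {in xpredT &, forall i j, j != i -> coprimep (p i) (p j)}.
  move=> i j _ _ ij; rewrite coprimep_expl // coprimep_expr // coprimep_XsubC.
  by rewrite root_XsubC nth_uniq ?undup_uniq // eq_sym.
have rkE (M : 'M[K]_n'.+1) g : (\rank (kermxpoly M g) = n'.+1 - \rank (horner_mx M g))%N.
  by rewrite mxrank_ker.
have rkP (M : 'M[K]_n'.+1) : (\rank (horner_mx M (\prod_i p i)) =
    n'.+1 - \sum_i \rank (kermxpoly M (p i)))%N.
  rewrite -(mxdirectP (mxdirect_sum_kermx M co_p)) /= -(kermxpoly_prod M co_p) rkE.
  by rewrite subKn ?rank_leq_row.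
rewrite !rkP; congr (_ - _)%N; apply: eq_bigr => i _.
by rewrite !rkE !horner_mx_XsubC_exp eq_rk.
Qed.

Theorem similar_power (F : finFieldType) (K : closedFieldType)
    (iota : {rmorphism F -> K}) n' (A : 'M[F]_n'.+1) N k :
    (0 < N)%N -> A ^+ N = 1 -> coprime k N ->
    (forall a, eigenvalue (map_mx iota A) a -> same_jordan (map_mx iota A) a (a ^+ k)) ->
  exists2 T, T \in unitmx & A *m T = T *m A ^+ k.
Proof.
move=> N0 AN co_kN sjA; apply: similar_rank => f.
rewrite -!(mxrank_map iota) !map_horner_mx; apply/esym.
have iAN : (map_mx iota A) ^+ N = 1 by rewrite -rmorphXn AN rmorph1.
rewrite rmorphXn; apply: mxrank_horner_closed => a j.
exact: same_jordan_power co_kN sjA a j.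
Qed.

(** * Norms in finite rings with involution *)

(** For an action of a group of order two on a finite abelian group, the orders of
the two Tate cohomology groups are equal (the Herbrand quotient is 1). So if
Hilbert 90 holds, then all fixed points are norms. *)
Lemma norm_onto_fixed (gT : finGroupType) (U : {group gT}) (s : gT -> gT) :
    abelian U -> {in U, forall x, s x \in U} -> {in U &, {morph s : x y / (x * y)%g}} ->
    {in U, forall x, s (s x) = x} ->
    {in U, forall x, (x * s x = 1)%g -> exists2 y, y \in U & (s y * y^-1)%g = x} ->
  {in U, forall a, s a = a -> exists2 c, c \in U & (c * s c)%g = a}.
Proof.
move=> /centsP cUU Us sM sK H90.
have normM : {in U &, {morph (fun x => x * s x)%g : x y / (x * y)%g}}.
  move=> x y Ux Uy /=; rewrite sM // !mulgA; congr (_ * _)%g; rewrite -!mulgA.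
  by congr (_ * _)%g; apply: cUU; rewrite ?Us.
have quoM : {in U &, {morph (fun x => s x * x^-1)%g : x y / (x * y)%g}}.
  move=> x y Ux Uy /=; rewrite sM // invMg -!mulgA; congr (_ * _)%g; rewrite mulgA.
  by rewrite (cUU (s y * y^-1)%g) ?groupM ?groupV ?Us.
pose N := Morphism normM; pose M := Morphism quoM.
pose U0 := [set x in U | s x == x].
have card_im (f : {morphism U >-> gT}) : (#|f @* U| * #|'ker f| = #|U|)%N.
  by rewrite card_morphim setIid mulnC Lagrange // subsetIl.
have kerM : 'ker M = U0.
  apply/setP=> x; rewrite 2!inE [RHS]inE /=; apply: andb_id2l => Ux.
  by rewrite inE -eq_mulgV1.
have kerN : 'ker N \subset M @* U.
  apply/subsetP=> x; rewrite 3!inE /= => /andP[Ux /eqP/(H90 x Ux)[y Uy <-]].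
  exact: (mem_morphim M Uy Uy).
have imN : N @* U \subset U0.
  apply/subsetP=> _ /morphimP[x Ux _ ->]; rewrite inE /= groupM ?Us //.
  by rewrite sM ?Us // sK //; apply/eqP/cUU; rewrite ?Us.
have NU0 : N @* U = U0.
  apply/eqP; rewrite eqEcard imN -kerM -(@leq_pmul2r #|M @* U|) ?cardG_gt0 //.
  by rewrite mulnC card_im -(card_im N) leq_pmul2l ?cardG_gt0 // subset_leq_card.
move=> a Ua sa; have : a \in N @* U by rewrite NU0 inE Ua sa eqxx.
by case/morphimP=> c Uc _ ->; exists c.
Qed.

Lemma exprD_orth (R : pzRingType) (u v : R) m :
  (0 < m)%N -> u * v = 0 -> v * u = 0 -> (u + v) ^+ m = u ^+ m + v ^+ m.
Proof.
case: m => // m _ uv vu; elim: m => // m IHm; rewrite exprS IHm mulrDl !mulrDr -!exprS.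
have -> : u * v ^+ m.+1 = 0 by rewrite exprS mulrA uv mul0r.
have -> : v * u ^+ m.+1 = 0 by rewrite exprS mulrA vu mul0r.
by rewrite addr0 add0r.
Qed.

Lemma idem_expr (R : pzRingType) (u : R) m : (0 < m)%N -> u * u = u -> u ^+ m = u.
Proof.
by case: m => // m _ uu; elim: m => // m IHm; rewrite exprS IHm.
Qed.

Lemma nilpotentB (R : pzRingType) (u v : R) m :
  GRing.comm u v -> u ^+ m = 0 -> v ^+ m = 0 -> (u - v) ^+ (m + m) = 0.
Proof.
move=> cuv um vm; rewrite exprBn_comm // big1 // => i _.
have [le_im | lt_mi] := leqP i m.
  by rewrite -addnBA // exprD um mul0r mulr0 mul0r mul0rn.
by rewrite -(subnK (ltnW lt_mi)) [v ^+ _]exprD vm !mulr0 mul0rn.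
Qed.

(** An exponent that works for all x at once is a multiple of the period of the
sequence of powers of each x and exceeds its preperiod. *)
Lemma finite_idempotent_power (R : finPzRingType) : exists2 m, (0 < m)%N &
  forall x : R, x ^+ m * x ^+ m = x ^+ m.
Proof.
exists #|R|`!; first exact: fact_gt0.
move=> x; set k := #|R|.
have /injectivePn[i [j ij]] : ~~ injectiveb (fun i : 'I_k.+1 => x ^+ i).
  by apply/injectiveP=> /leq_card; rewrite card_ord ltnn.
wlog lt_ij : i j ij / (i < j)%N => [IH eq_ij | /= eq_ij].
  have [/IH|/IH|/val_inj/eqP] := ltngtP i j; last by rewrite (negPf ij).
    exact.
  by rewrite eq_sym; apply.
have per e : (i <= e)%N -> x ^+ (e + (j - i)) = x ^+ e.
  move=> le_ie; rewrite -(subnK le_ie) -addnA subnKC ?(ltnW lt_ij) //.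
  by rewrite !exprD eq_ij.
have pers e s : (i <= e)%N -> x ^+ (e + s * (j - i)) = x ^+ e.
  move=> le_ie; elim: s => [|s IHs]; first by rewrite addn0.
  by rewrite mulSn addnCA addnC per ?IHs // (leq_trans le_ie) ?leq_addr.
have le_jk : (j <= k)%N by rewrite -ltnS.
have /dvdnP[s Ds] : (j - i %| k`!)%N.
  by rewrite dvdn_fact // subn_gt0 lt_ij (leq_trans (leq_subr _ _)).
rewrite -exprD {2}Ds pers // (leq_trans (ltnW lt_ij)) // (leq_trans le_jk) //.
exact: fact_geq.
Qed.

(** In the application R is a matrix ring over a finite field of order q ^ 2, star is
the conjugate transpose and lam is a scalar outside the field of order q: the
assumption on lam says that star is an involution of the second kind. *)
Section Star.
Variables (R : finUnitRingType) (star : R -> R).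
Hypotheses (starD : {morph star : x y / x + y})
  (starM : forall x y, star (x * y) = star y * star x)
  (starK : involutive star).
Variable lam : R.
Hypotheses (lamC : forall x, lam * x = x * lam)
  (lamU : star lam - lam \is a GRing.unit).

Variable a : R.
Hypothesis star_a : star a = a.

(** The double centralizer of a. It is a commutative subring containing a and the
center, it is star-stable because a is, and it is closed under inverses without
any computation: this makes it more convenient than the subring generated by a
and the center. *)
Definition bicomm (x : R) := [forall y, (y * a == a * y) ==> (x * y == y * x)].

Lemma bicommP x : reflect (forall y, y * a = a * y -> x * y = y * x) (bicomm x).
Proof.
apply: (iffP forallP) => [Bx y /eqP ya | Bx y].
  by apply/eqP; move: (Bx y); rewrite ya.
by apply/implyP=> /eqP/Bx->.
Qed.

Let B := bicomm.

Lemma bicomm_comm x : B x -> x * a = a * x.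
Proof. by move/bicommP; apply. Qed.

Lemma bicommC x y : B x -> B y -> x * y = y * x.
Proof. by move=> /bicommP Bx /bicomm_comm/Bx. Qed.

Lemma bicommD x y : B x -> B y -> B (x + y).
Proof.
by move=> /bicommP Bx /bicommP By; apply/bicommP=> z az; rewrite mulrDl mulrDr Bx ?By.
Qed.

Lemma bicommM x y : B x -> B y -> B (x * y).
Proof.
move=> /bicommP Bx /bicommP By; apply/bicommP=> z az.
by rewrite -mulrA By // mulrA Bx // mulrA.
Qed.

Lemma bicommN x : B x -> B (- x).
Proof. by move=> /bicommP Bx; apply/bicommP=> z az; rewrite mulNr mulrN Bx. Qed.

Lemma bicomm1 : B 1.
Proof. by apply/bicommP=> z _; rewrite mul1r mulr1. Qed.

Lemma bicommX x m : B x -> B (x ^+ m).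
Proof.
by move=> Bx; elim: m => [|m IHm]; [apply: bicomm1 | rewrite exprS bicommM].
Qed.

Lemma bicomm_star x : B x -> B (star x).
Proof.
move=> /bicommP Bx; apply/bicommP=> z az; rewrite -[z]starK -!starM Bx //.
by rewrite -{1}star_a -starM -az starM star_a.
Qed.

Lemma bicomm_lam : B lam.
Proof. by apply/bicommP=> z _; apply: lamC. Qed.

Lemma star1 : star 1 = 1.
Proof. by rewrite -[LHS]mulr1 -{2}[1]starK -starM mulr1 starK. Qed.

Lemma starX x m : star (x ^+ m) = star x ^+ m.
Proof.
by elim: m => [|m IHm]; rewrite ?expr0 ?star1 // exprS starM IHm -exprSr.
Qed.

Lemma starB x y : star (x - y) = star x - star y.
Proof. by apply/(addIr (star y)); rewrite -starD !subrK. Qed.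

(** The solutions d of star d = b d form a module D over the fixed points of star,
and each b' + star(b b') is one of them, so that D spans the double centralizer
over the center. So (1 - e) D can not consist of nilpotent elements for an
idempotent e different from 1, and a solution whose idempotent power is maximal
is a unit. *)
Lemma hilbert90 b : B b -> b * star b = 1 ->
  exists2 d, B d /\ d \is a GRing.unit & star d = b * d.
Proof.
move=> Bb bb1; have [m m_gt0 idem] := finite_idempotent_power R.
have Bsb := bicomm_star Bb.
have b1b : star b * b = 1 by rewrite bicommC.
pose D := [pred d | B d && (star d == b * d)].
have D0 : D 0 by rewrite inE; apply/andP; split; [apply/bicommP=> z _ | apply/eqP];
  rewrite ?mul0r ?mulr0 // -[X in star X](subrr 1) starB subrr.
pose fixed y := [set x : R | x * y ^+ m == x].
(* Idempotent powers are compared through the sets of elements that they fix. *)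
have [d dD dmax] : exists2 d, D d & forall y, D y -> (#|fixed y| <= #|fixed d|)%N.
  by case: (arg_maxnP (fun y => #|fixed y|) D0) => d; exists d.
have /andP[Bd /eqP sd] := dD.
have bm1 : b ^+ m = 1.
  have Ub : b \is a GRing.unit by apply/unitrP; exists (star b).
  by apply: (mulrI (unitrX m Ub)); rewrite idem mulr1.
pose e := d ^+ m.
have Be : B e by apply: bicommX.
have ee : e * e = e by apply: idem.
have se : star e = e.
  by rewrite starX sd exprMn_comm ?bm1 ?mul1r //; apply: bicommC.
have Be' : B (1 - e) by rewrite bicommD ?bicomm1 ?bicommN.
have e'e : (1 - e) * e = 0 by rewrite mulrBl mul1r ee subrr.
have e'e' : (1 - e) * (1 - e) = 1 - e by rewrite mulrBr mulr1 e'e subr0.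
have ee'0 : e * (1 - e) = 0 by rewrite mulrBr mulr1 ee subrr.
(* Otherwise d * e + (1 - e) * z would have a larger idempotent power. *)
have nil z : D z -> ((1 - e) * z) ^+ m = 0.
  case/andP=> Bz /eqP sz; set y := (1 - e) * z.
  have By : B y by apply: bicommM.
  have Dy : D (d * e + y).
    rewrite inE bicommD ?bicommM //=; apply/eqP.
    rewrite starD starM se sd /y starM starB star1 se sz [RHS]mulrDr.
    rewrite (bicommC Be) ?bicommM // -mulrA; congr (_ + _).
    by rewrite -mulrA (bicommC Bz).
  have y_e : y * e = 0 by rewrite bicommC // mulrA ee'0 mul0r.
  have e_y : e * y = 0 by rewrite bicommC.
  have Dm : (d * e + y) ^+ m = e + y ^+ m.
    have dey : d * e * y = 0 by rewrite -mulrA e_y mulr0.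
    have yde : y * (d * e) = 0 by rewrite (bicommC By) ?bicommM.
    rewrite exprD_orth // exprMn_comm; last exact: bicommC.
    by rewrite -/e idem_expr // ee.
  have := dmax _ Dy; rewrite /fixed Dm -/e => le_card.
  set f := y ^+ m in le_card *.
  have ff : f * f = f by apply: idem.
  have [f_e e_f] : f * e = 0 /\ e * f = 0.
    rewrite /f -(prednK m_gt0) {1}exprSr exprS -mulrA y_e mulr0.
    by rewrite mulrA e_y mul0r.
  have sub : [set x : R | x * e == x] \subset [set x : R | x * (e + f) == x].
    apply/subsetP=> x; rewrite !inE => /eqP xe.
    by rewrite -xe -mulrA mulrDr ee e_f addr0 xe.
  have := subset_leqif_cards sub; rewrite /leqif eqn_leq le_card andbT.
  move=> -[-> /esym/eqP/setP/(_ f)].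
  by rewrite !inE mulrDr f_e add0r ff eqxx eq_sym => /eqP.
(* The solutions z and l obtained from 1 and lam combine into a unit, so that a
   unit multiple of 1 - e is nilpotent and e = 1. *)
have D1 y : B y -> D (y + star b * star y).
  move=> By; rewrite inE bicommD ?bicommM ?bicomm_star //=; apply/eqP.
  rewrite starD starM !starK mulrDr mulrA bb1 mul1r addrC; congr (_ + _).
  exact: bicommC.
have [Dz Dl] := (D1 1 bicomm1, D1 lam bicomm_lam).
move: Dz Dl; set z := 1 + _; set l := lam + _ => Dz Dl.
have [/andP[Bz _] /andP[Bl _]] := (Dz, Dl).
have Bsl := bicomm_star bicomm_lam.
have Dw : (1 - e) * (star lam - lam) = star lam * ((1 - e) * z) - (1 - e) * l.
  rewrite mulrA (bicommC Bsl Be') -mulrA -mulrBr; congr (_ * _).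
  rewrite /z /l star1 mulr1 mulrDr mulr1 (bicommC Bsl Bsb) opprD addrACA subrr.
  by rewrite addr0.
have : ((1 - e) * (star lam - lam)) ^+ (m + m) = 0.
  rewrite Dw; apply: nilpotentB; last exact: nil.
    by apply: bicommC; rewrite !bicommM.
  rewrite exprMn_comm ?nil ?mulr0 //.
  by apply: bicommC; rewrite ?bicommM.
rewrite exprMn_comm; last by apply: bicommC; rewrite // bicommD ?bicommN ?bicomm_lam.
rewrite idem_expr ?addn_gt0 ?m_gt0 // => /eqP.
rewrite -[X in _ == X](mul0r ((star lam - lam) ^+ (m + m))).
rewrite (inj_eq (mulIr (unitrX _ lamU))).
rewrite subr_eq0 => /eqP e1.
exists d => //; split=> //.
by rewrite -(unitrX_pos _ m_gt0) -/e -e1 unitr1.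
Qed.

(** The counting argument of [norm_onto_fixed] in the unit group of the double
centralizer of a. Finding c there is the point: it commutes with everything that
commutes with a. *)
Lemma hermitian_norm : a \is a GRing.unit ->
  exists2 c, B c /\ c \is a GRing.unit & c * star c = a.
Proof.
move=> Ua.
have starU x : x \is a GRing.unit -> star x \is a GRing.unit.
  case/unitrP=> y [yx xy]; apply/unitrP; exists (star y).
  by rewrite -!starM yx xy star1.
pose s (u : {unit R}) : {unit R} := insubd u (star (val u)).
have sE u : val (s u) = star (val u) by rewrite val_insubd starU ?(valP u).
have gU : group_set [set u : {unit R} | B (val u)].
  apply/group_setP; split=> [|u v]; rewrite !inE; first exact: bicomm1.
  exact: bicommM.
pose U := Group gU.
have inU u : (u \in U) = B (val u) by rewrite inE.
have Us : {in U, forall u, s u \in U}.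
  by move=> u; rewrite !inU sE; apply: bicomm_star.
have [|||||| c Uc Dc] := @norm_onto_fixed _ U s _ Us _ _ _ (FinRing.unit R Ua).
- apply/centsP=> u; rewrite inU => Bu v; rewrite inU => Bv.
  by apply/val_inj; apply: bicommC.
- move=> u v; rewrite !inU => Bu Bv; apply/val_inj.
  by rewrite sE /= starM !sE bicommC ?bicomm_star.
- by move=> u _; apply/val_inj; rewrite !sE starK.
- move=> u; rewrite inU => Bu /(congr1 val); rewrite /= sE => uu1.
  have [d [Bd Ud] sd] := hilbert90 Bu uu1.
  exists (FinRing.unit R Ud); first by rewrite inU.
  by apply/val_inj; rewrite /= sE /= sd mulrK.
- by rewrite inU /=; apply/bicommP.
- by apply/val_inj; rewrite sE.
exists (val c); first by rewrite -inU Uc (valP c).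
by move/(congr1 val): Dc; rewrite /= sE.
Qed.

End Star.

(** * Spectral projectors of a matrix of finite order *)
Lemma geometric_sum_unity (K : fieldType) (x : K) N : x ^+ N = 1 -> x != 1 ->
  \sum_(j < N) x ^+ j = 0.
Proof.
move=> xN x1; apply: (mulfI (_ : x - 1 != 0)); first by rewrite subr_eq0.
by rewrite -subrX1 xN subrr mulr0.
Qed.

Lemma sum_expr_shift (R : pzRingType) (x : R) N : x ^+ N = 1 ->
  \sum_(j < N) x ^+ j.+1 = \sum_(j < N) x ^+ j.
Proof.
case: N => [|N] xN; first by rewrite !big_ord0.
by rewrite big_ord_recr [RHS]big_ord_recl /= addrC xN.
Qed.

Lemma sum_expr_inv (R : pzRingType) (x y : R) N : x ^+ N = 1 -> x * y = 1 ->
  \sum_(j < N) y ^+ j = \sum_(j < N) x ^+ j.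
Proof.
move=> xN xy; rewrite -(sum_expr_shift xN) (reindex_inj rev_ord_inj) /=.
apply: eq_bigr => j _; rewrite -[LHS]mul1r -xN -{1}(subnKC (ltn_ord j)).
rewrite exprD -mulrA; set m := (N - j.+1)%N.
suff -> : x ^+ m * y ^+ m = 1 by rewrite mulr1.
elim: (m) => [|i IHi]; first by rewrite mulr1.
by rewrite exprSr exprS mulrA -[X in X * _]mulrA xy mulr1.
Qed.

Section Projectors.
Variables (K : fieldType) (n' : nat).
Local Notation n := n'.+1.
Variables (N : nat) (S : 'M[K]_n).
Hypotheses (NK : N%:R != 0 :> K) (SN : S ^+ N = 1).

(** The projector onto the eigenspace of S for a, by Fourier inversion on the cyclic
group generated by S. *)
Definition eigenproj (S : 'M[K]_n) (a : K) : 'M[K]_n :=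
  N%:R^-1 *: \sum_(j < N) (a^-1 *: S) ^+ j.

Let N_gt0 : (0 < N)%N.
Proof. by rewrite lt0n; apply: contraNneq NK => ->. Qed.

Lemma unity_neq0 (a : K) : a ^+ N = 1 -> a != 0.
Proof. exact: expr1_neq0 N_gt0. Qed.

Lemma mul_eigenproj (m : nat) (D : 'M_(m, n)) a b : a ^+ N = 1 -> b ^+ N = 1 ->
  D *m S = b *: D -> D *m eigenproj S a = (a == b)%:R *: D.
Proof.
move=> aN bN DS.
have DX j : D *m (a^-1 *: S) ^+ j = (a^-1 * b) ^+ j *: D.
  by apply: mulmx_eigen_expr; rewrite -scalemxAr DS scalerA.
rewrite -scalemxAr mulmx_sumr; under eq_bigr do rewrite DX.
rewrite -scaler_suml scalerA; congr (_ *: _).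
have a0 := unity_neq0 aN.
have [<- | ab] := eqVneq a b.
  by rewrite mulVf //; under eq_bigr do rewrite expr1n; rewrite sumr_const card_ord mulVf.
rewrite geometric_sum_unity ?mulr0 // ?exprMn ?exprVn ?aN ?bN ?invr1 ?mulr1 //.
by rewrite -(inj_eq (mulfI a0)) mulrA mulfV // mul1r mulr1 eq_sym.
Qed.

Lemma eigenproj_eigen a : a ^+ N = 1 -> eigenproj S a *m S = a *: eigenproj S a.
Proof.
move=> aN; have a0 := unity_neq0 aN.
rewrite -scalemxAl scalerA mulrC -scalerA; congr (_ *: _).
pose x := a^-1 *: S; have -> : S = a *: x by rewrite scalerA mulfV ?scale1r.
rewrite -scalemxAr scalerA mulVf // scale1r; congr (_ *: _).
rewrite mulmxE mulr_suml; under eq_bigr do rewrite -exprSr.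
by rewrite sum_expr_shift // exprZn exprVn aN SN invr1 scale1r.
Qed.

Lemma eigenprojM a b : a ^+ N = 1 -> b ^+ N = 1 ->
  eigenproj S a *m eigenproj S b = (b == a)%:R *: eigenproj S a.
Proof. by move=> aN bN; rewrite (mul_eigenproj bN aN) ?eigenproj_eigen. Qed.

Lemma eigenproj_inv S' a : S *m S' = 1 -> a ^+ N = 1 ->
  eigenproj S' a^-1 = eigenproj S a.
Proof.
move=> SS' aN; have a0 := unity_neq0 aN; congr (_ *: _); apply: sum_expr_inv.
  by rewrite exprZn exprVn aN SN invr1 scale1r.
by rewrite invrK -scalerAl -scalerAr scalerA mulVf // scale1r.
Qed.

Variable O : seq K.
Hypotheses (O_uniq : uniq O) (ON : {in O, forall a, a ^+ N = 1}).

(** The matrix with eigenvalue a mu instead of mu on the eigenspace of S for each mu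
in O, acting trivially on the other eigenspaces. *)
Definition spectral (a : K -> K) : 'M[K]_n :=
  1 + \sum_(mu <- O) (a mu - 1) *: eigenproj S mu.

Lemma mul_spectral (m : nat) (D : 'M_(m, n)) a b : b ^+ N = 1 ->
  D *m S = b *: D -> D *m spectral a = (if b \in O then a b else 1) *: D.
Proof.
move=> bN DS; rewrite mulmxDr mulmx1 mulmx_sumr big_seq.
under eq_bigr => mu Omu do
  rewrite -scalemxAr (mul_eigenproj (ON Omu) bN DS) scalerA.
rewrite -scaler_suml -[X in X + _]scale1r -scalerDl; congr (_ *: _).
have [bO | bO] := boolP (b \in O).
  rewrite -big_seq (bigD1_seq b) //= eqxx mulr1 big1 ?addr0 ?subrKC //.
  by move=> mu /negPf->; rewrite mulr0.
rewrite big1_seq ?addr0 // => mu /andP[_ Omu].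
by case: eqP => [Db | _]; [rewrite -Db Omu in bO | rewrite mulr0].
Qed.

Lemma spectralM a b : spectral a * spectral b = spectral (fun mu => a mu * b mu).
Proof.
rewrite {1}/spectral mulrDl mul1r {1}/spectral -addrA; congr (_ + _).
rewrite mulr_suml -big_split; apply: eq_big_seq => mu Omu /=.
rewrite -scalerAl -mulmxE (mul_spectral b (ON Omu) (eigenproj_eigen (ON Omu))) Omu.
rewrite [_ *: (b mu *: _)]scalerA -scalerDl; congr (_ *: _).
by rewrite mulrBl mul1r addrC subrKA.
Qed.

Lemma spectral1 a : {in O, forall mu, a mu = 1} -> spectral a = 1.
Proof.
move=> a1; rewrite /spectral big1_seq ?addr0 // => mu /andP[_ Omu].
by rewrite a1 // subrr scale0r.
Qed.

Lemma spectralX a m : spectral a ^+ m = spectral (fun mu => a mu ^+ m).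
Proof.
elim: m => [|m IHm]; first by rewrite expr0 spectral1.
rewrite exprSr IHm spectralM /spectral; congr (_ + _).
by apply: eq_bigr => mu _; rewrite exprSr.
Qed.

End Projectors.

Lemma trmxX (R : comNzRingType) n' (A : 'M[R]_n'.+1) m : (A ^+ m)^T = A^T ^+ m.
Proof.
elim: m => [|m IHm]; first exact: trmx1.
by rewrite exprS exprSr -!mulmxE trmx_mul IHm.
Qed.

Lemma map_eigenproj (K : fieldType) (f : {rmorphism K -> K}) n' N (S : 'M[K]_n'.+1) a :
  map_mx f (eigenproj N S a) = eigenproj N (map_mx f S) (f a).
Proof.
rewrite map_mxZ fmorphV rmorph_nat rmorph_sum; congr (_ *: _).
by apply: eq_bigr => j _; rewrite rmorphXn /= map_mxZ fmorphV.
Qed.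

Lemma trmx_eigenproj (K : fieldType) n' N (S : 'M[K]_n'.+1) a :
  (eigenproj N S a)^T = eigenproj N S^T a.
Proof.
rewrite linearZ /= raddf_sum; congr (_ *: _); apply: eq_bigr => j _ /=.
by rewrite trmxX linearZ.
Qed.

(** * General linear and unitary groups as fixed points *)

(** The characteristic is a phantom argument, so that the ring morphism instance can
be found from the term. *)
Definition powFrobenius (R : fieldType) (p k : nat) of p \in [pchar R] :=
  fun x : R => x ^+ (p ^ k).

Section PowFrobenius.
Variables (R : fieldType) (p k : nat) (pR : p \in [pchar R]).
Local Notation frob := (powFrobenius k pR).

Fact powFrobenius_zmod : zmod_morphism frob.
Proof.
move=> x y; rewrite /powFrobenius; elim: k => [|m IHm]; first by rewrite !expr1.
by rewrite expnSr !exprM IHm -!(pFrobenius_autE pR) rmorphB.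
Qed.

Fact powFrobenius_monoid : monoid_morphism frob.
Proof. by split=> [|x y]; rewrite /powFrobenius ?expr1n ?exprMn. Qed.

HB.instance Definition _ := GRing.isZmodMorphism.Build R R frob powFrobenius_zmod.
HB.instance Definition _ := GRing.isMonoidMorphism.Build R R frob powFrobenius_monoid.

End PowFrobenius.

Lemma finField_image (F : finFieldType) (K : fieldType) (iota : {rmorphism F -> K}) x :
  x ^+ #|F| = x -> exists y, iota y = x.
Proof.
move=> xF; have := congr1 (map_poly iota) (finField_genPoly F).
rewrite rmorphB /= map_polyXn map_polyX rmorph_prod /= => /(congr1 (horner^~ x)).
rewrite !hornerE xF subrr horner_prod => /esym/eqP/prodf_eq0[y _].
by rewrite rmorphB /= map_polyX map_polyC !hornerE subr_eq0 => /eqP->; exists y.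
Qed.

Lemma trmxZ (R : pzRingType) m n (a : R) (A : 'M_(m, n)) : (a *: A)^T = a *: A^T.
Proof. by apply/matrixP=> i j; rewrite !mxE. Qed.

Section Steinberg.
Variables (p k : nat) (eps : int) (F : finFieldType) (K : fieldType).
Variables (iota : {rmorphism F -> K}) (n : nat).
Local Notation q := (p ^ k)%N.
Hypotheses (p_prime : prime p) (cardF : #|F| = GLeps_field_order eps q).
Local Notation G := (GLeps F n eps q).
Local Notation M := 'M[K]_n.-1.+1.

Lemma pcharF : p \in [pchar F].
Proof.
move: cardF; rewrite /GLeps_field_order; case: ifP => _ cF.
  exact: card_finPcharP cF p_prime.
by rewrite -expnM in cF; apply: card_finPcharP cF p_prime.
Qed.

Lemma pcharK : p \in [pchar K].
Proof. by rewrite (fmorph_pchar iota) pcharF. Qed.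

Local Notation frobK := (powFrobenius k pcharK).
Local Notation frobF := (powFrobenius k pcharF).

Lemma iota_frob x : iota (frobF x) = frobK (iota x).
Proof. exact: rmorphXn. Qed.

(** The fixed points in GL_n(K) of the Steinberg endomorphism that defines G, namely
entrywise q-th power, followed by inverse transpose in the unitary case. *)
Definition steinberg_fixed (A : M) : Prop :=
  if eps == 1 then map_mx frobK A = A else A *m (map_mx frobK A)^T = 1%:M.

Lemma GU_mx (g : {'GL_n[F]}) :
  (g \in GU F n q) = (GLval g *m (map_mx frobF (GLval g))^T == 1%:M).
Proof.
have formE u v : hermitian_form q u v = (u *m (map_mx frobF v)^T) 0 0.
  by rewrite !mxE; apply: eq_bigr => i _; rewrite !mxE.
have formM (u v : 'rV[F]_n.-1.+1) A : hermitian_form q (u *m A) (v *m A) =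
    (u *m (A *m (map_mx frobF A)^T) *m (map_mx frobF v)^T) 0 0.
  by rewrite formE map_mxM trmx_mul !mulmxA.
rewrite inE; apply/'forall_'forall_eqP/eqP=> [gP | gg u v]; last first.
  by rewrite formM gg mulmx1 formE.
have entry A i j : ((delta_mx 0 i : 'rV_n.-1.+1) *m A *m
    (map_mx frobF (delta_mx 0 j : 'rV_n.-1.+1))^T) 0 0 = A i j.
  by rewrite map_delta_mx trmx_delta -colE -rowE !mxE.
apply/matrixP=> i j; have := gP (delta_mx 0 i) (delta_mx 0 j).
by rewrite formM entry formE -[delta_mx 0 i]mulmx1 entry.
Qed.

Lemma natural_steinberg g : g \in G -> steinberg_fixed (natural_mx iota g).
Proof.
have frob_nat : map_mx frobK (natural_mx iota g) = map_mx iota (map_mx frobF (GLval g)).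
  by apply/matrixP=> i j; rewrite !mxE iota_frob.
rewrite /GLeps /steinberg_fixed frob_nat; move: cardF; rewrite /GLeps_field_order.
case: ifP => _ cF.
  move=> _; congr map_mx; apply/matrixP=> i j; rewrite !mxE.
  by rewrite /powFrobenius -cF expf_card.
by rewrite GU_mx => /eqP gg; rewrite matrix.map_trmx -map_mxM gg map_mx1.
Qed.

(** In the unitary case, applying the Steinberg endomorphism twice shows that the
entries of A are fixed by x |-> x ^ (q ^ 2), so they come from F in both cases. *)
Lemma steinberg_natural A : A \in unitmx -> steinberg_fixed A ->
  exists2 g, g \in G & natural_mx iota g = A.
Proof.
move=> UA fixA.
have fixF i j : (A i j) ^+ #|F| = A i j.
  move: fixA cardF; rewrite /steinberg_fixed /GLeps_field_order; case: ifP => _ fixA -> //.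
    by rewrite -[in RHS]fixA mxE.
  set A' := map_mx frobK A in fixA.
  have A'A : A'^T *m A = 1%:M by apply: mulmx1C.
  have: map_mx frobK A' = A.
    rewrite -[LHS]mulmx1 -A'A mulmxA -[A in RHS]mul1mx; congr (_ *m _).
    move/(congr1 (map_mx frobK)): fixA; rewrite map_mxM map_mx1 -matrix.map_trmx -/A'.
    by move/(congr1 trmx); rewrite trmx_mul trmxK trmx1 mulmxE.
  move/matrixP/(_ i j); rewrite !mxE /powFrobenius => Aij.
  by rewrite -[RHS]Aij -exprM mulnn.
have /fin_all_exists[B BA] : forall i, exists r : 'rV[F]_n.-1.+1, map_mx iota r = row i A.
  move=> i; have /fin_all_exists[r rA] : forall j, exists y, iota y = A i j.
    by move=> j; apply: finField_image; apply: fixF.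
  by exists (\row_j r j); apply/rowP=> j; rewrite !mxE rA.
pose g0 : 'M_n.-1.+1 := \matrix_i B i.
have g0A : map_mx iota g0 = A by apply/row_matrixP=> i; rewrite -map_row rowK BA.
have Ug0 : g0 \is a GRing.unit by rewrite -g0A map_unitmx in UA.
pose g : {'GL_n[F]} := FinRing.unit _ Ug0.
have gA : natural_mx iota g = A by rewrite /natural_mx.
exists g => //; rewrite /GLeps; case: ifP fixA => [_ _ | e1]; first exact: in_setT.
rewrite /steinberg_fixed e1 -gA => fixg.
rewrite GU_mx; apply/eqP/(map_mx_inj (f := iota)); rewrite map_mx1 -[RHS]fixg map_mxM.
congr (_ *m _); rewrite -matrix.map_trmx; congr (_^T).
by apply/matrixP=> i j; rewrite !mxE iota_frob.
Qed.

(** On N-th roots of unity the action x |-> x ^ q or x |-> x ^ (-q) of the Steinberg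
endomorphism is a power map with a natural exponent. *)
Definition steinberg_exp N := if eps == 1 then q else (N.-1 * q)%N.

Lemma unity_pred_inv (a : K) N : (0 < N)%N -> a ^+ N = 1 -> a ^+ N.-1 = a^-1.
Proof.
move=> N0 aN; have a0 := expr1_neq0 N0 aN.
by apply: (mulfI a0); rewrite -exprS prednK // aN mulfV.
Qed.

Lemma mxrank_frob_sub (A : M) a j :
  \rank ((A - a%:M) ^+ j) = \rank ((map_mx frobK A - (a ^+ q)%:M) ^+ j).
Proof.
by rewrite -(mxrank_map frobK) rmorphXn rmorphB /= map_scalar_mx.
Qed.

(** Apply the Steinberg endomorphism to A - a. In the unitary case the result involves
A^-1 - a ^ q, which differs from A - a ^ (-q) by a unit commuting with it. *)
Lemma steinberg_jordan A N a : (0 < N)%N -> steinberg_fixed A -> a ^+ N = 1 ->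
  same_jordan A a (a ^+ steinberg_exp N).
Proof.
move=> N0; rewrite /steinberg_fixed /steinberg_exp; case: ifP => _ fixA aN j.
  by rewrite mxrank_frob_sub fixA.
rewrite mxrank_frob_sub -mxrank_tr trmxX linearB /= tr_scalar_mx.
set B := (map_mx frobK A)^T in fixA *; rewrite exprM unity_pred_inv // exprVn.
set b := a ^+ q; have b0 : b != 0 by rewrite expf_neq0 ?(expr1_neq0 N0 aN).
have BA : B *m A = 1%:M by apply: mulmx1C.
have [UB _] := mulmx1_unit BA.
have -> : B - b%:M = - b *: (B *m (A - b^-1%:M)).
  rewrite mulmxBr BA mul_mx_scalar scalerBr scalerA mulNr mulfV // scaleN1r opprK.
  by rewrite scaleNr -scalemx1 addrC.
have cBA : GRing.comm B (A - b^-1%:M).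
  by rewrite /GRing.comm mulrBl mulrBr -!mulmxE BA fixA scalar_mxC.
rewrite exprZn exprMn_comm // mxrank_scale_nz ?expf_neq0 ?oppr_eq0 //.
by rewrite -mulmxE eqmxMfull // row_full_unit unitrX.
Qed.

Lemma coprime_expr_inj (c N : nat) : coprime c N ->
  {in [pred x : K | x ^+ N == 1] &, injective (fun x => x ^+ c)}.
Proof.
move=> co x y; rewrite !inE => /eqP xN /eqP yN xy.
case: (posnP N) co => [-> | N0 co].
  by rewrite /coprime gcdn0 => /eqP c1; move: xy; rewrite c1 !expr1.
have e z : z ^+ N = 1 -> z = (z ^+ c) ^+ (c ^ (totient N).-1) :> K.
  move=> zN; rewrite -exprM -expnS prednK ?totient_gt0 //.
  by rewrite -(expr_mod _ zN) Euler_exp_totient // expr_mod.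
by rewrite (e x) // (e y) // xy.
Qed.

Lemma perm_expr (c N : nat) (O : seq K) : coprime c N -> uniq O ->
    {in O, forall a, a ^+ N = 1} -> {in O, forall a, a ^+ c \in O} ->
  perm_eq [seq a ^+ c | a <- O] O.
Proof.
move=> co uO ON Oc.
have u' : uniq [seq a ^+ c | a <- O].
  rewrite map_inj_in_uniq // => x y Ox Oy; apply: coprime_expr_inj co _ _ _ _;
  by rewrite inE ON.
have sub : {subset [seq a ^+ c | a <- O] <= O} by move=> _ /mapP[a /Oc Oa ->].
by apply: uniq_perm => //; apply: (uniq_min_size u' sub _).2; rewrite size_map.
Qed.

Lemma coprime_steinberg_exp N : (0 < N)%N -> coprime p N -> coprime (steinberg_exp N) N.
Proof.
move=> N0 co_p; have co_q : coprime q N by rewrite coprimeXl.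
rewrite /steinberg_exp; case: ifP => // _; rewrite coprimeMl co_q andbT.
by case: N N0 {co_p co_q} => // N _; rewrite coprimenS.
Qed.

(** The Steinberg endomorphism permutes the spectral projectors of S in the same way
as the eigenvalues, so it fixes the part of S supported by a stable set of
eigenvalues. *)
Lemma steinberg_spectral (S : M) N (O : seq K) :
    (0 < N)%N -> coprime p N -> steinberg_fixed S -> S ^+ N = 1 -> uniq O ->
    {in O, forall a, a ^+ N = 1} -> {in O, forall a, a ^+ steinberg_exp N \in O} ->
  steinberg_fixed (spectral N S O id).
Proof.
move=> N0 co_p fixS SN uO ON Oc.
have NK : N%:R != 0 :> K by rewrite -(dvdn_pcharf pcharK) -prime_coprime.
have := perm_expr (coprime_steinberg_exp N0 co_p) uO ON Oc.
have mapE : map_mx frobK (spectral N S O id) =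
    1 + \sum_(mu <- O) (mu ^+ q - 1) *: eigenproj N (map_mx frobK S) (mu ^+ q).
  rewrite rmorphD rmorph1 rmorph_sum; congr (_ + _); apply: eq_bigr => mu _ /=.
  by rewrite map_mxZ map_eigenproj rmorphB rmorph1.
move: fixS; rewrite /steinberg_fixed /steinberg_exp mapE; case: ifP => _ fixS permO.
  rewrite fixS /spectral; congr (_ + _).
  by rewrite -[RHS](perm_big _ permO) big_map.
suff -> : (1 + \sum_(mu <- O) (mu ^+ q - 1) *: eigenproj N (map_mx frobK S) (mu ^+ q))^T
    = spectral N S O GRing.inv.
  rewrite mulmxE spectralM // spectral1 // => mu /ON muN.
  by rewrite mulfV // (unity_neq0 NK muN).
rewrite raddfD /= trmx1 raddf_sum /spectral; congr (_ + _).
rewrite -[RHS](perm_big _ permO) big_map; apply: eq_big_seq => mu /ON muN /=.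
rewrite exprM unity_pred_inv // exprVn invrK trmxZ trmx_eigenproj.
rewrite -(eigenproj_inv NK SN fixS) ?invrK //.
by rewrite exprVn exprAC muN expr1n invr1.
Qed.

End Steinberg.

(** * Conjugacy in unitary groups *)
Section UnitaryConjugacy.
Variables (F : finFieldType) (n' : nat) (sigma : {rmorphism F -> F}).
Hypothesis sigmaK : involutive sigma.
Variable lam : F.
Hypothesis lam_moved : sigma lam != lam.
Local Notation n := n'.+1.
Implicit Types A B x y : 'M[F]_n.

Definition adjointmx A : 'M[F]_n := (map_mx sigma A)^T.

Lemma adjointmxM A B : adjointmx (A * B) = adjointmx B * adjointmx A.
Proof. by rewrite /adjointmx map_mxM trmx_mul. Qed.

Lemma adjointmxK : involutive adjointmx.
Proof. by move=> A; apply/matrixP=> i j; rewrite !mxE sigmaK. Qed.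

(** From A x = x B with A and B unitary, x x^* commutes with A. Write it as c c^*
with c commuting with A, and correct x into c^-1 x. *)
Lemma unitary_conj A B x : A * adjointmx A = 1 -> B * adjointmx B = 1 ->
    x \is a GRing.unit -> A * x = x * B ->
  exists y, [/\ y \is a GRing.unit, y * adjointmx y = 1 & A * y = y * B].
Proof.
move=> AA BB Ux AxB.
have adjD : {morph adjointmx : X Y / X + Y}.
  by move=> X Y; rewrite /adjointmx map_mxD linearD.
have lamC (X : 'M[F]_n) : lam%:M * X = X * lam%:M by rewrite -!mulmxE scalar_mxC.
have lamU : adjointmx lam%:M - lam%:M \is a GRing.unit.
  rewrite /adjointmx map_scalar_mx tr_scalar_mx -raddfB /=.
  by rewrite -scalemx1 scaler_unit ?unitr1 // unitfE subr_eq0.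
pose a := x * adjointmx x.
have star_a : adjointmx a = a by rewrite adjointmxM adjointmxK.
have adj1 : adjointmx 1 = 1 by rewrite /adjointmx map_mx1 trmx1.
have Ustar y : y \is a GRing.unit -> adjointmx y \is a GRing.unit.
  move=> Uy; apply/unitrP; exists (adjointmx y^-1).
  by rewrite -!adjointmxM mulVr ?mulrV ?adj1.
have Ua : a \is a GRing.unit by rewrite unitrMl ?Ustar.
have aA : A * a = a * A.
  have : adjointmx x * adjointmx A = adjointmx B * adjointmx x.
    by rewrite -!adjointmxM AxB.
  move/(congr1 (fun X => B * X * A)) => /= xA; rewrite !mulrA BB mul1r in xA.
  rewrite /a mulrA AxB -!mulrA; congr (_ * _); rewrite -xA.
  have A'A : adjointmx A * A = 1 by apply: mulmx1C.
  by rewrite -[RHS]mulrA A'A mulr1.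
have [c [/bicommP Bc Uc] cc] :=
  hermitian_norm adjD adjointmxM adjointmxK lamC lamU star_a Ua.
have Ac := Bc A aA.
exists (c^-1 * x); split; first by rewrite unitrMl ?unitrV.
  rewrite adjointmxM mulrA -(mulrA _ x) -/a -cc mulrA mulVr // mul1r.
  by rewrite -adjointmxM mulVr.
by rewrite -mulrA -AxB mulrA -[A in LHS](mulKr Uc) Ac -!mulrA mulVKr // !mulrA.
Qed.

End UnitaryConjugacy.

Section Conjugacy.
Variables (p k : nat) (eps : int) (F : finFieldType) (n : nat).
Local Notation q := (p ^ k)%N.
Hypotheses (p_prime : prime p) (k_gt0 : (0 < k)%N).
Hypotheses (cardF : #|F| = GLeps_field_order eps q).
Local Notation G := (GLeps F n eps q).

Lemma conj_GLeps (g h : {'GL_n[F]}) (x : 'M[F]_n.-1.+1) : g \in G -> h \in G ->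
  x \in unitmx -> GLval g *m x = x *m GLval h -> h \in (g ^: G)%g.
Proof.
move=> Gg Gh Ux gx.
have conjE (y : {'GL_n[F]}) : GLval g *m GLval y = GLval y *m GLval h -> h = (g ^ y)%g.
  by move=> gy; apply/(mulgI y)/val_inj; rewrite -conjgC /= -!mulmxE gy.
have pF := pcharF p_prime cardF; move: cardF Gg Gh.
rewrite /GLeps /GLeps_field_order; case: ifP => _ cF.
  by move=> Gg Gh; rewrite (conjE (FinRing.unit _ Ux) gx) memJ_class ?in_setT.
rewrite !(GU_mx p_prime cardF) => /eqP gg /eqP hh.
pose frob := powFrobenius k pF.
have frobK : involutive frob.
  by move=> y; rewrite /frob /powFrobenius -exprM mulnn -cF expf_card.
(* Otherwise 'X^q - 'X would have q ^ 2 roots in F. *)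
have [lam lam_moved] : exists lam, frob lam != lam.
  apply/existsP; rewrite -[[exists _, _]]negbK negb_exists; apply/negP=> /forallP fixF.
  have q1 : (1 < q)%N by rewrite -(exp1n k) ltn_exp2r ?prime_gt1.
  pose P : {poly F} := 'X^q - 'X.
  have szP : size P = q.+1.
    by rewrite size_polyDl size_polyXn // size_polyN size_polyX.
  have P0 : P != 0 by rewrite -size_poly_gt0 szP.
  have := max_poly_roots P0 (_ : all (root P) (enum F)) (enum_uniq F).
  rewrite -cardE cF szP ltnS leqNgt -{1}(expn1 q) ltn_exp2l // => contra.
  suff: false by []. apply: contra.
  apply/allP=> y _; rewrite /root !hornerE subr_eq0; have := fixF y.
  by rewrite negbK.
have [y [Uy yy gy]] := unitary_conj frobK lam_moved gg hh Ux gx.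
rewrite (conjE (FinRing.unit _ Uy) gy) memJ_class // (GU_mx p_prime cardF).
exact/eqP.
Qed.

End Conjugacy.

(** * Brauer characters of semisimple elements *)
Lemma char_poly_similar (K : fieldType) n (A B P : 'M[K]_n) :
  P \in unitmx -> A *m P = P *m B -> char_poly A = char_poly B.
Proof.
move=> UP AP; pose Q := map_mx polyC P.
have QAB : char_poly_mx A *m Q = Q *m char_poly_mx B.
  by rewrite mulmxBl mulmxBr -scalar_mxC -!map_mxM AP.
have: char_poly A * \det Q = char_poly B * \det Q.
  by rewrite [RHS]mulrC -!det_mulmx QAB.
apply: mulIf; rewrite det_map_mx polyC_eq0 -unitfE.
by rewrite -unitmxE.
Qed.

Lemma diagonalizable_unity (K : closedFieldType) n' N (A : 'M[K]_n'.+1) :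
    N%:R != 0 :> K -> A ^+ N = 1 ->
  exists P (d : 'rV_n'.+1), P \in unitmx /\ A *m P = P *m diag_mx d.
Proof.
move=> NK AN; have N0 : (0 < N)%N by rewrite lt0n; apply: contraNneq NK => ->.
have [rs Drs] := closed_field_poly_normal ('X^N - 1 : {poly K}).
rewrite (monicP _) ?monicXnsubC // scale1r in Drs.
have: diagonalizable A.
  apply/diagonalizableP; exists rs.
    by rewrite -separable_prod_XsubC -Drs separable_Xn_sub_1.
  rewrite -Drs dvd_mxminpoly rmorphB rmorphXn rmorph1 /= horner_mx_X.
  by rewrite AN subrr.
case=> P UP /(diagonalizable_forLR UP) [d DA].
exists (invmx P), d; rewrite unitmx_inv UP; split=> //.
by rewrite DA mxpoly.conjVmx // mulmxK.
Qed.

Lemma prod_eigenvalues (K : closedFieldType) n (A : 'M[K]_n) :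
  \prod_(z <- eigenvalues A) ('X - z%:P) = char_poly A.
Proof.
rewrite /eigenvalues; case: closed_field_poly_normal => rs /= Drs.
by rewrite [RHS]Drs (monicP (char_poly_monic A)) scale1r.
Qed.

Lemma eigenvalues_diag (K : closedFieldType) n (A P : 'M[K]_n) (d : 'rV_n) :
    P \in unitmx -> A *m P = P *m diag_mx d ->
  perm_eq (eigenvalues A) [seq d 0 i | i <- enum 'I_n].
Proof.
move=> UP AP; apply: prod_XsubC_eq; rewrite big_map big_enum /=.
rewrite prod_eigenvalues (char_poly_similar UP AP) char_poly_trig ?diag_mx_is_trig //.
by apply: eq_bigr => i _; rewrite mxE eqxx.
Qed.

Lemma diagX n' (R : comNzRingType) (d : 'rV[R]_n'.+1) j :
  diag_mx d ^+ j = diag_mx (map_mx (fun x => x ^+ j) d).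
Proof.
elim: j => [|j IHj].
  by rewrite expr0 -[1]diag_const_mx; congr diag_mx; apply/rowP=> i; rewrite !mxE.
rewrite exprS IHj -mulmxE mulmx_diag; congr diag_mx.
by apply/rowP=> i; rewrite !mxE exprS.
Qed.

Section RootLift.
Variables (p : nat) (K : closedFieldType) (theta : K -> algC).
Hypothesis theta_lift : is_root_lift p theta.

Lemma root_liftM x y : x != 0 -> y != 0 -> theta (x * y) = theta x * theta y.
Proof. by case: theta_lift => thM _ _ _; apply: thM. Qed.

Lemma root_lift_inj x y : x != 0 -> y != 0 -> theta x = theta y -> x = y.
Proof. by case: theta_lift => _ thI _ _; apply: thI. Qed.

Lemma root_lift1 : theta 1 = 1.
Proof.
case: theta_lift => _ _ /(_ 1 (oner_neq0 _))[m pm th1] _.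
have nz := expr1_neq0 (prim_order_gt0 th1) (prim_expr_order th1).
by apply: (mulfI nz); rewrite -root_liftM ?oner_neq0 // !mulr1.
Qed.

Lemma root_liftX x j : x != 0 -> theta (x ^+ j) = theta x ^+ j.
Proof.
move=> x0; elim: j => [|j IHj]; first exact: root_lift1.
by rewrite !exprS root_liftM ?expf_neq0 // IHj.
Qed.

Section Element.
Variables (F : finFieldType) (iota : {rmorphism F -> K}) (n : nat) (G : {group {'GL_n[F]}}).
Variable t : {'GL_n[F]}.
Hypothesis tK : #[t]%:R != 0 :> K.

Lemma GLvalX j : GLval (t ^+ j)%g = GLval t ^+ j.
Proof. by elim: j => // j IHj; rewrite exprSr -IHj expgSr. Qed.

Lemma natural_mxX j : natural_mx iota (t ^+ j)%g = natural_mx iota t ^+ j.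
Proof. by rewrite /natural_mx GLvalX rmorphXn. Qed.

Lemma Brauer_char_diag : exists d : 'I_n.-1.+1 -> K,
  [/\ forall i, d i ^+ #[t] = 1,
      forall a, eigenvalue (natural_mx iota t) a <-> exists i, a = d i
    & forall j, Brauer_char theta (natural_repr iota G) (t ^+ j)%g = \sum_i theta (d i) ^+ j].
Proof.
have tN : natural_mx iota t ^+ #[t] = 1.
  by rewrite -natural_mxX expg_order /natural_mx map_mx1.
have [P [d [UP tP]]] := diagonalizable_unity tK tN.
have tPX j : natural_mx iota t ^+ j *m P = P *m diag_mx (map_mx (fun x => x ^+ j) d).
  rewrite -diagX; elim: j => [|j IHj]; first by rewrite !expr0 mulmx1 mul1mx.
  by rewrite exprS -mulmxE -mulmxA IHj mulmxA tP exprS -!mulmxE mulmxA.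
have dN i : d 0 i ^+ #[t] = 1.
  have := tPX #[t]; rewrite tN mul1mx => /(congr1 (mulmx (invmx P))).
  by rewrite mulVmx // mulKmx // => /matrixP/(_ i i); rewrite !mxE eqxx.
exists (d 0); split=> // [a | j].
  rewrite eigenvalue_root_char (char_poly_similar UP tP) char_poly_trig ?diag_mx_is_trig //.
  split=> [|[i ->]].
    rewrite /root horner_prod => /eqP/eqP/prodf_eq0[i _].
    by rewrite !hornerE mxE eqxx subr_eq0 => /eqP->; exists i.
  rewrite /root horner_prod; apply/eqP/eqP/prodf_eq0; exists i => //.
  by rewrite !hornerE mxE eqxx subrr.
rewrite /Brauer_char /natural_repr /= natural_mxX.
rewrite (perm_big _ (eigenvalues_diag UP (tPX j))) /= big_map big_enum /=.
by apply: eq_bigr => i _; rewrite mxE root_liftX // (unity_neq0 tK (dN i)).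
Qed.

(** The values of the Brauer character on <[t]> are the power sums of the lifted
eigenvalues of t, and they determine these eigenvalues with multiplicities. *)
Lemma Brauer_char_eigenvalue_power m :
    (forall j, Brauer_char theta (natural_repr iota G) (t ^+ j ^+ m)%g
             = Brauer_char theta (natural_repr iota G) (t ^+ j)%g) ->
  forall a, eigenvalue (natural_mx iota t) a -> eigenvalue (natural_mx iota t) (a ^+ m).
Proof.
have [d [dN dE dB]] := Brauer_char_diag => eqB a /dE[i0 ->].
have d0 i : d i != 0 by apply: unity_neq0 tK _ (dN i).
have thN i : theta (d i) ^+ #[t] = 1 by rewrite -root_liftX // dN root_lift1.
pose w := theta (d i0) ^+ m; have wN : w ^+ #[t] = 1 by rewrite exprAC thN expr1n.
have w0 := expr1_neq0 (order_gt0 t) wN.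
(* Fourier inversion on <[t]>: the coefficient of a power sum at w is the
   multiplicity of w among its terms. *)
have count_w (x : 'I_n.-1.+1 -> algC) : (forall i, x i ^+ #[t] = 1) ->
    \sum_(j < #[t]) w^-1 ^+ j * \sum_i x i ^+ j = #[t]%:R * (\sum_i (x i == w)%:R).
  move=> xN; under eq_bigr do rewrite mulr_sumr.
  rewrite exchange_big mulr_sumr /=; apply: eq_bigr => i _.
  under eq_bigr do rewrite -exprMn.
  have [-> | xw] := eqVneq (x i) w.
    by rewrite mulVf //; under eq_bigr do rewrite expr1n; rewrite sumr_const card_ord mulr1.
  rewrite mulr0; apply: geometric_sum_unity; first by rewrite exprMn exprVn wN xN invr1 mulr1.
  by apply: contra_neq xw => wx1; rewrite -[LHS](mulVKf w0) wx1 mulr1.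
have eq_count : \sum_i (theta (d i) ^+ m == w)%:R = \sum_i (theta (d i) == w)%:R :> algC.
  apply: (mulfI (_ : #[t]%:R != 0)); first by rewrite pnatr_eq0 -lt0n order_gt0.
  rewrite -!count_w // => [|i]; last by rewrite exprAC thN expr1n.
  apply: eq_bigr => j _; congr (_ * _); rewrite -dB -eqB -expgM dB.
  by apply: eq_bigr => i _; rewrite -exprM mulnC.
have [i thi | none] := pickP (fun i => theta (d i) == w).
  apply/dE; exists i; apply: root_lift_inj; rewrite ?expf_neq0 //.
  by rewrite root_liftX // (eqP thi).
move/eqP: eq_count; rewrite [X in _ == X]big1 => [|i _]; last by rewrite none.
rewrite (bigD1 i0) //= eqxx gt_eqF //.
by rewrite ltr_wpDr // sumr_ge0 // => i _; rewrite ler0n.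
Qed.

End Element.
End RootLift.

(** * Galois descent for fields generated by sums of roots of unity *)
Section Qgen.
Variable S : algC -> Prop.

Lemma Qgen0 : Qgen S 0.
Proof. by rewrite -(subrr 1); apply: Qgen_sub; apply: Qgen_one. Qed.

Lemma QgenD x y : Qgen S x -> Qgen S y -> Qgen S (x + y).
Proof.
move=> Sx Sy; rewrite -[y]opprK; apply: Qgen_sub => //.
by rewrite -sub0r; apply: Qgen_sub => //; apply: Qgen0.
Qed.

Lemma QgenV x : Qgen S x -> Qgen S x^-1.
Proof. by rewrite -div1r; apply: Qgen_div; apply: Qgen_one. Qed.

Lemma QgenM x y : Qgen S x -> Qgen S y -> Qgen S (x * y).
Proof. by move=> Sx Sy; rewrite -[y]invrK; apply: Qgen_div => //; apply: QgenV. Qed.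

Lemma Qgen_int (m : int) : Qgen S m%:~R.
Proof.
have Snat (i : nat) : Qgen S i%:R.
  elim: i => [|i IHi]; first exact: Qgen0.
  by rewrite mulrS; apply: QgenD => //; apply: Qgen_one.
case: m => i; first exact: Snat.
by rewrite NegzE mulrNz -sub0r; apply: Qgen_sub; [apply: Qgen0 | apply: Snat].
Qed.

Lemma Qgen_rat (r : rat) : Qgen S (ratr r).
Proof. by apply: Qgen_div; apply: Qgen_int. Qed.

Lemma Qgen_trans S' z : (forall x, S x -> Qgen S' x) -> Qgen S z -> Qgen S' z.
Proof.
move=> SS'; elim=> [x /SS' //||x y _ Sx _ Sy|x y _ Sx _ Sy].
- exact: Qgen_one.
- exact: Qgen_sub.
- exact: Qgen_div.
Qed.

End Qgen.

Lemma Qgen_adjoin (L : splittingFieldType rat) (iota : {rmorphism L -> algC})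
    (S : algC -> Prop) (s : seq L) :
    (forall a, a \in s -> Qgen S (iota a)) ->
  forall b, b \in <<1 & s>>%VS -> Qgen S (iota b).
Proof.
elim/last_ind: s => [_ b | s x IHs sS b].
  rewrite adjoin_nil subfield_closed => /vlineP[r ->].
  by rewrite alg_num_field fmorph_rat; apply: Qgen_rat.
rewrite adjoin_rcons => /Fadjoin_polyP[f fs ->].
have Sx : Qgen S (iota x) by apply: sS; rewrite mem_rcons mem_head.
have Ss a : a \in <<1 & s>>%VS -> Qgen S (iota a).
  by apply: IHs => c sc; apply: sS; rewrite mem_rcons in_cons sc orbT.
rewrite horner_coef rmorph_sum; elim/big_ind: _ => [||i _]; first exact: Qgen0.
  exact: QgenD.
rewrite rmorphM rmorphXn; apply: QgenM; first exact/Ss/(polyOverP fs).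
elim: (nat_of_ord i) => [|j IHj]; first exact: Qgen_one.
by rewrite exprS; apply: QgenM.
Qed.

Definition root_of_unity_sum N (z : algC) :=
  exists m (r : 'I_m -> algC), (forall i, r i ^+ N = 1) /\ z = \sum_i r i.

(** The Galois correspondence in the cyclotomic field of order N: an element fixed by
all automorphisms that fix the f i lies in the field generated by the f i. *)
Lemma Qgen_galois (gT : finGroupType) (G : {group gT}) (I : finType)
    (f : I -> algC) (z : algC) (N := #|G|) :
    (forall i, root_of_unity_sum N (f i)) -> root_of_unity_sum N z ->
    (forall (nu : {rmorphism algC -> algC}) k, coprime k N ->
       (forall w, w ^+ N = 1 -> nu w = w ^+ k) ->
       (forall i, nu (f i) = f i) -> nu z = z) ->
  Qgen (fun x => exists i, x = f i) z.
Proof.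
move=> fN zN nuP.
have [L galL [LC gLC [w [pr_w Dw] _]]] := group_num_field_exists G.
rewrite -/N in pr_w.
have pr_Cw : N.-primitive_root (LC w) by rewrite fmorph_primitive_root.
have inL x : root_of_unity_sum N x -> exists a, LC a = x.
  case=> m [r [rN ->]]; have /fin_all_exists[a aP] : forall i, exists a, LC a = r i.
    move=> i; have [j ->] := prim_rootP pr_Cw (rN i).
    by exists (w ^+ j); rewrite rmorphXn.
  by exists (\sum_i a i); rewrite rmorph_sum; apply: eq_bigr => i _; rewrite aP.
have /fin_all_exists[a aP] : forall i, exists a, LC a = f i by move=> i; apply: inL.
have [b bP] := inL z zN.
pose s := [seq a i | i <- enum I]; pose E := <<1 & s>>%AS.
have galE : galois E {:L} by apply: galoisS galL; rewrite subvf sub1v.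
rewrite -bP; apply: (@Qgen_adjoin L LC _ s).
  by move=> _ /mapP[i _ ->]; apply: Qgen_mem; exists i.
rewrite -/(E : {vspace L}) -(galois_fixedField galE).
apply/fixedFieldP; first exact: memvf.
move=> x Ex; have [k co_k xw] := aut_prim_rootP x pr_w.
have [nu nuE] := gLC x.
apply: (fmorph_inj LC); rewrite nuE bP; apply: (nuP nu k) => // [v vN | i].
  have [j ->] := prim_rootP pr_Cw vN.
  by rewrite rmorphXn -nuE xw rmorphXn -!exprM mulnC.
rewrite -aP -nuE (fixed_gal _ Ex) ?subvf //.
by apply: seqv_sub_adjoin; apply: map_f; rewrite mem_enum.
Qed.

(** The common shape of the sequences of values of an ordinary or Brauer character at
the powers of a fixed element, the r i being the (lifted) eigenvalues. *)
Definition unity_power_sum N (f : nat -> algC) :=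
  exists m (r : 'I_m -> algC), (forall i, r i ^+ N = 1) /\
    forall j, f j = \sum_i r i ^+ j.

Lemma unity_power_sum1 N f : unity_power_sum N f -> root_of_unity_sum N (f 1%N).
Proof. by case=> m [r [rN fE]]; exists m, r; split=> //; apply: fE. Qed.

(** On character values, a Galois automorphism acts as a power map on group elements. *)
Lemma unity_power_sum_aut N f (nu : {rmorphism algC -> algC}) k :
  unity_power_sum N f -> (forall w, w ^+ N = 1 -> nu w = w ^+ k) -> nu (f 1%N) = f k.
Proof.
case=> m [r [rN fE]] nuP; rewrite !fE rmorph_sum.
by apply: eq_bigr => i _; rewrite expr1 nuP.
Qed.

Lemma char_power_sum (gT : finGroupType) (G : {group gT}) (chi : 'CF(G)) g :
  chi \is a character -> g \in G -> unity_power_sum #|G| (fun j => chi (g ^+ j)%g).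
Proof.
move=> Nchi Gg; have sgG : <[g]> \subset G by rewrite cycle_subG.
have [r Dr] := char_sum_irr (cfRes_char <[g]> Nchi).
have lin_i i : 'chi[<[g]>]_i \is a linear_char by rewrite irr_cyclic_lin ?cycle_cyclic.
exists (size r), (fun i => 'chi_(tnth (in_tuple r) i) g); split=> [i | j].
  by rewrite -lin_charX ?cycle_id // expg_cardG // lin_char1.
rewrite -(cfResE chi sgG) ?mem_cycle // Dr sum_cfunE big_tnth.
by apply: eq_bigr => i _; rewrite lin_charX ?cycle_id.
Qed.

(** * Powers of elements of general linear and unitary groups *)
Section PowerConjugacy.
Variables (p k : nat) (eps : int) (F : finFieldType) (K : closedFieldType).
Variables (iota : {rmorphism F -> K}) (theta : K -> algC) (n : nat).
Local Notation q := (p ^ k)%N.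
Hypotheses (p_prime : prime p) (k_gt0 : (0 < k)%N).
Hypotheses (cardF : #|F| = GLeps_field_order eps q).
Hypothesis theta_lift : is_root_lift p theta.
Local Notation G := (GLeps F n eps q).
Local Notation rho := (natural_repr iota G).
Let pK : p \in [pchar K] := pcharK iota p_prime cardF.

Lemma pow_p_inj e : injective (fun x : K => x ^+ (p ^ e)).
Proof. exact: (fmorph_inj (powFrobenius e pK)). Qed.

Lemma natural_mx_inj : injective (fun g : {'GL_n[F]} => natural_mx iota g).
Proof. by move=> g h gh; apply: val_inj; apply: (map_mx_inj (f := iota)) gh. Qed.

Lemma natural_mx_unity (g : {'GL_n[F]}) N : (g ^+ N = 1)%g -> natural_mx iota g ^+ N = 1.
Proof. by move=> gN; rewrite -natural_mxX gN /natural_mx map_mx1. Qed.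

Lemma p'nat_neq0 N : coprime p N -> N%:R != 0 :> K.
Proof. by rewrite -(dvdn_pcharf pK) -prime_coprime. Qed.

Lemma spectral_mul_eigenproj n' N (S : 'M[K]_n'.+1) (O : seq K) a mu :
    N%:R != 0 :> K -> S ^+ N = 1 -> uniq O -> {in O, forall a, a ^+ N = 1} -> mu \in O ->
  spectral N S O a *m eigenproj N S mu = a mu *: eigenproj N S mu.
Proof.
move=> NK SN uO ON Omu; rewrite mulmxDl mul1mx mulmx_suml.
rewrite (bigD1_seq mu) //= big1_seq => [|nu /andP[nu_mu Onu]].
  rewrite addr0 -scalemxAl eigenprojM ?ON // eqxx scale1r scalerBl scale1r.
  by rewrite addrC subrK.
by rewrite -scalemxAl eigenprojM ?ON // eq_sym (negPf nu_mu) scale0r scaler0.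
Qed.

(** Let t be the part of s supported by the orbit O of b. The hypothesis makes b ^ m an
eigenvalue of t. Unless b = 1, it is different from 1, and an eigenvector w of t
for b ^ m must have a nonzero component on an eigenspace of s for some mu in O,
where t acts as mu. *)
Lemma semisimple_eigenvalue_power (s : {'GL_n[F]}) m (N := #[s]) b :
    s \in G -> coprime p N -> coprime m N ->
    (forall t, t \in G -> p^'.-elt t ->
       Brauer_char theta rho (t ^+ m)%g = Brauer_char theta rho t) ->
    eigenvalue (natural_mx iota s) b ->
  exists i, b ^+ m = b ^+ (steinberg_exp p k eps N ^ i).
Proof.
move=> Gs co_pN co_mN BrP eig_b; set c := steinberg_exp _ _ _ _.
set S := natural_mx iota s in eig_b.
have N0 : (0 < N)%N := order_gt0 s.
have NK := p'nat_neq0 co_pN.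
have SN : S ^+ N = 1 by apply: natural_mx_unity; apply: expg_order.
have bN := eigenvalue_expr SN eig_b.
have bXN j : (b ^+ j) ^+ N = 1 by rewrite exprAC bN expr1n.
have co_c : coprime c N by apply: coprime_steinberg_exp.
pose O := undup [seq b ^+ (c ^ i) | i <- seq.iota 0 (totient N)].
have OP x : reflect (exists i, x = b ^+ (c ^ i)) (x \in O).
  rewrite mem_undup; apply: (iffP mapP) => [[i _ ->] | [i ->]]; first by exists i.
  exists (i %% totient N)%N; first by rewrite mem_iota ltn_mod totient_gt0.
  have cE : (c ^ i = c ^ (i %% totient N) %[mod N])%N.
    rewrite {1}(divn_eq i (totient N)) expnD [(i %/ _ * _)%N]mulnC expnM.
    by rewrite -modnMml -modnXm Euler_exp_totient // modnXm exp1n modnMml mul1n.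
  by rewrite -(expr_mod _ bN) cE expr_mod.
have ON : {in O, forall a, a ^+ N = 1} by move=> _ /OP[i ->].
have Oc : {in O, forall a, a ^+ c \in O}.
  by move=> _ /OP[i ->]; apply/OP; exists i.+1; rewrite -exprM -expnSr.
have Ob : b \in O by apply/OP; exists 0%N; rewrite expn0 expr1.
have uO : uniq O := undup_uniq _.
pose T := spectral N S O id.
have fixT : steinberg_fixed iota p_prime cardF T.
  by apply: steinberg_spectral => //; apply: natural_steinberg.
have TN : T ^+ N = 1 by rewrite spectralX // spectral1.
have UT : T \in unitmx by rewrite -[T \in _](unitrX_pos _ N0) TN unitr1.
have [t Gt Dt] := steinberg_natural UT fixT.
have tN : (t ^+ N = 1)%g.
  by apply: natural_mx_inj; rewrite natural_mxX Dt TN /natural_mx map_mx1.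
have t_dvd : (#[t] %| N)%N by rewrite order_dvdn tN.
have co_pt : coprime p #[t] by apply: coprime_dvdr co_pN.
have p't j : p^'.-elt (t ^+ j)%g.
  rewrite /p_elt p'natE // -prime_coprime //.
  by apply: coprime_dvdr co_pt; apply: orderXdvd.
have eqB j : Brauer_char theta rho (t ^+ j ^+ m)%g = Brauer_char theta rho (t ^+ j)%g.
  by apply: BrP; rewrite // groupX.
have eigT : eigenvalue (natural_mx iota t) b.
  rewrite Dt; case/eigenvalueP: eig_b => v vS v0; apply/eigenvalueP; exists v => //.
  by rewrite (mul_spectral NK _ _ _ bN vS) // Ob.
have := Brauer_char_eigenvalue_power theta_lift (p'nat_neq0 co_pt) eqB eigT.
rewrite Dt => /eigenvalueP[w wT w0].
have [b1 | b1] := eqVneq b 1; first by exists 0%N; rewrite b1 !expr1n.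
have bm1 : b ^+ m != 1.
  by apply: contraNneq b1 => bm; apply/eqP/(coprime_expr_inj co_mN);
     rewrite ?inE ?bN ?expr1n.
have [mu Omu wmu] : exists2 mu, mu \in O & w *m eigenproj N S mu != 0.
  apply/hasP; rewrite -[has _ _]negbK; apply/hasPn=> no_mu.
  case/eqP: bm1; apply/eqP; rewrite -subr_eq0.
  have: (b ^+ m - 1) *: w == 0.
    rewrite scalerBl -wT scale1r mulmxDr mulmx1 addrAC subrr add0r mulmx_sumr.
    rewrite big1_seq // => mu /andP[_ /no_mu]; rewrite negbK => /eqP wmu0.
    by rewrite -(scalemxAr _ w (eigenproj N S mu)) wmu0 scaler0.
  by rewrite scaler_eq0 (negPf w0) orbF.
apply/OP; suff -> : b ^+ m = mu by [].
have := spectral_mul_eigenproj id NK SN uO ON Omu.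
move/(congr1 (mulmx w)); rewrite mulmxA wT -scalemxAl.
rewrite -(scalemxAr _ w (eigenproj N S mu)) => /eqP.
by rewrite -subr_eq0 -scalerBl scaler_eq0 (negPf wmu) orbF subr_eq0 => /eqP.
Qed.

(** For an eigenvalue a of g, [semisimple_eigenvalue_power] applies to a ^ P and the
p'-element g ^ P, where P is the p-part of the order of g. As raising to the power
P is injective on K, it follows that a ^ m is in the orbit of a under the action of
the Steinberg endomorphism. *)
Theorem power_conj (g : {'GL_n[F]}) m : g \in G -> coprime m #|G| ->
    (forall t, t \in G -> p^'.-elt t ->
       Brauer_char theta rho (t ^+ m)%g = Brauer_char theta rho t) ->
  (g ^+ m)%g \in (g ^: G)%g.
Proof.
move=> Gg co_m BrP; set A := natural_mx iota g.
have co_mg : coprime m #[g] by apply: coprime_dvdr (order_dvdG Gg) co_m.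
pose P := (p ^ logn p #[g])%N; pose s := (g ^+ P)%g; pose N := #[s].
have DN : N = (#[g]`_p^')%N.
  rewrite /N orderXdiv; last exact: pfactor_dvdnn.
  by rewrite -{1}(partnC p (order_gt0 g)) p_part mulKn // expn_gt0 prime_gt0.
have co_pN : coprime p N by rewrite prime_coprime // -p'natE // DN part_pnat.
have DgPN : (#[g] = P * N)%N by rewrite DN /P -p_part partnC.
have Gs : s \in G by rewrite groupX.
have co_mN : coprime m N by apply: coprime_dvdr co_mg; rewrite DgPN dvdn_mull.
have Ag : A ^+ #[g] = 1 by apply: natural_mx_unity; apply: expg_order.
have N0 : (0 < N)%N by apply: order_gt0.
have fixA : steinberg_fixed iota p_prime cardF A by apply: natural_steinberg.
have [||T UT gT] := @similar_power F K iota _ (GLval g) _ m (order_gt0 g) _ co_mg.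
- by rewrite -GLvalX expg_order.
- move=> a eig_a.
  have aN : a ^+ N = 1.
    apply: (@pow_p_inj (logn p #[g])).
    by rewrite /= -exprM mulnC -DgPN expr1n (eigenvalue_expr Ag eig_a).
  have eig_s : eigenvalue (natural_mx iota s) (a ^+ P).
    case/eigenvalueP: eig_a => v vA v0; apply/eigenvalueP; exists v => //.
    by rewrite natural_mxX; apply: mulmx_eigen_expr.
  have [i] := semisimple_eigenvalue_power Gs co_pN co_mN BrP eig_s.
  rewrite exprAC [RHS]exprAC => /pow_p_inj ->.
  set c := steinberg_exp _ _ _ _; elim: i => [|i IHi]; first by rewrite expn0 expr1.
  have aiN : (a ^+ (c ^ i)) ^+ N = 1 by rewrite exprAC aN expr1n.
  move=> j; rewrite IHi expnSr exprM.
  exact: (steinberg_jordan N0 fixA aiN).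
by apply: (conj_GLeps p_prime k_gt0 cardF Gg (groupX m Gg) UT); rewrite GLvalX.
Qed.

End PowerConjugacy.

Lemma Brauer_power_sum (p : nat) (F : finFieldType) (K : closedFieldType)
    (iota : {rmorphism F -> K}) (theta : K -> algC) (n : nat)
    (G : {group {'GL_n[F]}}) (t : {'GL_n[F]}) :
    is_root_lift p theta -> t \in G -> #[t]%:R != 0 :> K ->
  unity_power_sum #|G| (fun j => Brauer_char theta (natural_repr iota G) (t ^+ j)%g).
Proof.
move=> lift Gt tK; have [d [dN _ dB]] := Brauer_char_diag lift iota G tK.
exists _, (fun i => theta (d i)); split=> [i|]; last exact: dB.
have d0 : d i != 0 by apply: unity_neq0 tK _ (dN i).
have /dvdnP[e ->] := order_dvdG Gt.
by rewrite mulnC exprM -(root_liftX lift _ d0) dN (root_lift1 lift) expr1n.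
Qed.

Lemma Brauer_charJ (F : finFieldType) (K : closedFieldType)
    (iota : {rmorphism F -> K}) (theta : K -> algC) (n : nat)
    (G : {group {'GL_n[F]}}) (t y : {'GL_n[F]}) :
  Brauer_char theta (natural_repr iota G) (t ^ y)%g =
    Brauer_char theta (natural_repr iota G) t.
Proof.
rewrite /Brauer_char; apply: perm_big; apply: prod_XsubC_eq.
rewrite !prod_eigenvalues; apply/esym/(@char_poly_similar K _ _ _ (natural_mx iota y)).
  by rewrite map_unitmx; apply: (valP y).
by rewrite -!map_mxM; congr map_mx; rewrite !mulmxE; apply: (congr1 val (conjgC t y)).
Qed.

Theorem corollary3p9 (p k q n : nat) (eps : int) (F : finFieldType)
    (K : closedFieldType) (iota : {rmorphism F -> K}) (theta : K -> algC)
    (p_prime : prime p) (k_gt0 : (0 < k)%N) (q_def : q = (p ^ k)%N)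
    (n_gt0 : (0 < n)%N) (eps_sign : eps = 1 \/ eps = -1)
    (cardF : #|F| = GLeps_field_order eps q)
    (K_closure : is_algebraic_closure iota)
    (theta_lift : is_root_lift p theta) :
  forall z : algC,
    Q_Brauer p theta (natural_repr iota (GLeps F n eps q)) z
    <-> Q_group (GLeps F n eps q) z.
Proof.
subst q; set G := GLeps F n eps (p ^ k); set rho := natural_repr iota G.
have tK (t : {'GL_n[F]}) : p^'.-elt t -> #[t]%:R != 0 :> K.
  move=> p't; apply: (p'nat_neq0 iota p_prime cardF).
  by rewrite prime_coprime // -p'natE.
pose br t := Brauer_char theta rho t.
have brS t : t \in G -> p^'.-elt t -> unity_power_sum #|G| (fun j => br (t ^+ j)%g).
  by move=> Gt /tK; apply: Brauer_power_sum theta_lift Gt.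
have chiS (i : Iirr G) g : g \in G -> unity_power_sum #|G| (fun j => 'chi_i (g ^+ j)%g).
  by apply: char_power_sum; apply: irr_char.
have zeroS : root_of_unity_sum #|G| 0.
  by exists 0%N, (fun=> 1); split=> [i|]; rewrite ?expr1n ?big_ord0.
have oneS t f : unity_power_sum #|G| f -> f 1%N = t -> root_of_unity_sum #|G| t.
  by move=> /unity_power_sum1 ? <-.
move=> z; split; apply: Qgen_trans => {}z.
- case=> t [Gt p't ->]; have St := brS t Gt p't.
  pose f (ig : Iirr G * {'GL_n[F]}) := if ig.2 \in G then 'chi_ig.1 ig.2 else 0.
  apply: (@Qgen_trans (fun x => exists ig, x = f ig)) => [_ [[i g] ->]|].
    rewrite /f /=; case: ifP => Gg; last exact: Qgen0.
    by apply: Qgen_mem; exists i, g.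
  apply: (@Qgen_galois _ G).
  + case=> i g; rewrite /f /=; case: ifP => // Gg.
    by apply: oneS (chiS i g Gg) _; rewrite expg1.
  + by apply: oneS St _; rewrite expg1.
  move=> nu m co_m nuX nuf; have := unity_power_sum_aut St nuX.
  rewrite expg1 => ->.
  have : (t ^+ m)%g \in (t ^: G)%g.
    apply/(eq_irr_mem_classP _ Gt) => i.
    rewrite -(unity_power_sum_aut (chiS i t Gt) nuX) expg1.
    by have := nuf (i, t); rewrite /f /= Gt.
  by case/imsetP=> y _ ->; rewrite /br Brauer_charJ.
case=> i [g [Gg ->]].
pose f (t : {'GL_n[F]}) := if (t \in G) && p^'.-elt t then br t else 0.
apply: (@Qgen_trans (fun x => exists t, x = f t)) => [_ [t ->]|].
  rewrite /f /=; case: ifP => [/andP[Gt p't]|_]; last exact: Qgen0.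
  by apply: Qgen_mem; exists t.
have Sg := chiS i g Gg.
apply: (@Qgen_galois _ G).
- move=> t; rewrite /f; case: ifP => // /andP[Gt p't].
  by apply: oneS (brS t Gt p't) _; rewrite expg1.
- by apply: oneS Sg _; rewrite expg1.
move=> nu m co_m nuX nuf; have := unity_power_sum_aut Sg nuX.
rewrite expg1 => ->.
apply/(eq_irr_mem_classP _ Gg).
apply: (power_conj (iota := iota) p_prime k_gt0 cardF theta_lift Gg co_m) => t Gt p't.
change (br (t ^+ m)%g = br t).
rewrite -(unity_power_sum_aut (brS t Gt p't) nuX) expg1.
by have := nuf t; rewrite /f Gt p't.
Qed.
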